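(* For every $\alpha\in(0,2]$ there is a constant $c(\alpha)>0$ depending only on $\alpha$ such that the following holds. Let $n\ge 1$, let $\{\delta_i\}_{1\le i\le n}$ and $\{\zeta_i\}_{1\le i\le n}$ be two sequences of random variables that are independent of each other, where $\delta_1,\dots,\delta_n$ are independent with $\delta_i\sim\mathrm{Bernoulli}(p_i)$, and $\zeta_1,\dots,\zeta_n$ are independent centered $\alpha$-sub-exponential random variables. Put $\xi=(\xi_1,\dots,\xi_n)^\top$ with $\xi_i=\delta_i\zeta_i$, let $A=(a_{ij})_{n\times n}$ be a fixed real symmetric matrix, and let $L(\alpha)=\max_i\|\zeta_i\|_{\Psi_\alpha}$, assumed positive. Then for all $t\ge 0$, $$\mathbb{P}\left\{|\xi^\top A\xi-\mathbb{E}\,\xi^\top A\xi|\ge L(\alpha)^2t\right\}\le 2\exp\left(-c(\alpha)\min\left\{\frac{t^2}{\sum_{k}a_{kk}^2p_k+\sum_{i\ne j}a_{ij}^2p_ip_j},\ \left(\frac{t}{\|A\|_{l_2\to l_2}}\right)^{\alpha/2}\right\}\right).$$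
   Context: $\delta\sim\mathrm{Bernoulli}(p)$, $p\in[0,1]$, means $\delta\in\{0,1\}$ with $\mathbb{P}(\delta=1)=p$. A random variable $\eta$ is $\alpha$-sub-exponential if for some $K>0$, $\mathbb{P}\{|\eta|\ge t\}\le 2\exp(-t^\alpha/K^\alpha)$ for all $t\ge0$; its $\alpha$-sub-exponential norm is $\|\eta\|_{\Psi_\alpha}=\inf\{t>0:\mathbb{E}\exp(|\eta|^\alpha/t^\alpha)\le 2\}$. Centered means mean zero. $\|A\|_{l_2\to l_2}$ is the spectral (operator) norm. Quotients with zero denominator are read as $x/0=+\infty$ for $x>0$ and $0/0=0$. *)

(* Defs.v *)
From HB Require Import structures.
From mathcomp Require Import all_boot all_order all_algebra.
From mathcomp Require Import all_classical all_reals all_analysis.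

Set Implicit Arguments.
Unset Strict Implicit.
Unset Printing Implicit Defensive.

Import Order.TTheory GRing.Theory Num.Theory.
Import numFieldNormedType.Exports.

Local Open Scope classical_set_scope.
Local Open Scope ring_scope.

Section random_variables.
Context d (T : measurableType d) (R : realType) (P : probability T R).

(* A condition on the law only: the values are 0 or 1 almost surely. *)
Definition is_bernoulli (delta : T -> R) (p : R) : Prop :=
  [/\ 0 <= p <= 1,
      {ae P, forall w, delta w = 0 \/ delta w = 1}
    & P [set w | delta w = 1] = p%:E].

Definition sub_exponential (alpha : R) (eta : T -> R) : Prop :=
  exists2 K : R, 0 < K & forall t : R, 0 <= t ->
    (P [set w | (t <= `|eta w|)%R]
       <= (2 * expR (- (t `^ alpha / K `^ alpha)))%:E)%E.

(* For alpha-sub-exponential eta the set below is nonempty, so that the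
   real-valued [inf] is the genuine infimum. *)
Definition psi_norm (alpha : R) (eta : T -> R) : R :=
  inf [set t : R | 0 < t /\
    ('E_P[fun w => expR (`|eta w| `^ alpha / t `^ alpha)] <= 2%:E)%E].

Definition mutually_independent n (X : 'I_n -> T -> R) : Prop :=
  forall (J : {set 'I_n}) (B : 'I_n -> set R),
    (forall i, measurable (B i)) ->
    P (\bigcap_(i in [set` J]) (X i @^-1` B i)) =
      (\prod_(i in J) P (X i @^-1` B i))%E.

(* The sequences X and Y are independent of each other as random vectors:
   the sigma-algebras sigma(X_i, i < n) and sigma(Y_i, i < n) are independent. *)
Definition independent_sequences n (X Y : 'I_n -> T -> R) : Prop :=
  forall E F : set T, g_sigma_preimage X E -> g_sigma_preimage Y F ->
    P (E `&` F) = (P E * P F)%E.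

End random_variables.

Section linear_algebra.
Context {R : realType} {n : nat}.

(* The norm the library puts on matrices and vectors is the sup norm. *)
Definition l2norm (x : 'cV[R]_n) : R := Num.sqrt (\sum_i x i ord0 ^+ 2).

Definition opnorm (A : 'M[R]_n) : R :=
  sup [set l2norm (A *m x) | x in [set x : 'cV[R]_n | l2norm x <= 1]].

Definition quad_form (A : 'M[R]_n) (x : 'cV[R]_n) : R :=
  (x^T *m A *m x) ord0 ord0.

End linear_algebra.

(* The division is that of the extended reals, for which x / 0 = +oo when
   0 < x and 0 / 0 = 0 (because 0^-1 = +oo and 0 * +oo = 0). *)
Definition hw_exponent (R : realType) n (alpha : R) (p : 'I_n -> R)
    (A : 'M[R]_n) (t : R) : \bar R :=
  (Order.min
    ((t ^+ 2)%:E /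
     (\sum_k A k k ^+ 2 * p k
      + \sum_i \sum_(j | i != j) A i j ^+ 2 * p i * p j)%:E)
    ((t%:E / (opnorm A)%:E) `^ (alpha / 2)))%E.

(* Main.v *)
Require Import Defs.
From HB Require Import structures.
From mathcomp Require Import all_boot all_order all_algebra.
From mathcomp Require Import all_classical all_reals all_analysis.
From mathcomp Require Import measurable_realfun.
From mathcomp Require Import ring lra zify.

Set Implicit Arguments.
Unset Strict Implicit.
Unset Printing Implicit Defensive.

Import Order.TTheory GRing.Theory Num.Theory.
Import numFieldNormedType.Exports.

Local Open Scope ring_scope.

(**
The argument compares moments of order [r = 2 ^ k]; no truncation, decoupling
copy or Gaussian is needed.  Rescale to [x_i = delta_i zeta_i / (2 L)] and put
[kappa = r ^ (2 / alpha - 1)].  Up to order [2 r] the moments of [x_i] are at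
most those of [sqrt kappa] times a standard Gaussian switched on with
probability [p_i / kappa], up to a constant [C ^ l].

Writing the off-diagonal form as an average of the bipartite forms
[sum_(i in S, j notin S) a_ij x_i x_j], expanding in the [x_i], [i in S], gives
the moment of order [r / 2] of the quadratic form
[C kappa * sum_(i in V) (sum_(j notin S) a_ij x_j) ^ 2], where the random set
[V] contains [i] with probability [p_i / kappa].  Its diagonal is a sum of
independent terms, and its off-diagonal part has matrix [A_V^T A_V], whose
operator norm is quadratically smaller than that of [A]: so the claim
[E Y_A ^ r / r! <= exp (C' sum_(i <> j) a_ij ^ 2 p_i p_j)], for
[kappa * norm A] small, passes from [r / 2] to [r] with the same [C'].
Markov's inequality for a power of two [r] of order
[min (t ^ 2 / variance) ((t / norm A) ^ (alpha / 2))] concludes. *)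

(** * Divided powers *)

Section divided_powers.
Context {R : realType}.
Implicit Types x y : R.

(** For [alpha < 2] the exponential moments of the form are in general infinite, so the argument
    stays at one finite order. Divided powers keep the algebra of the exponential there: sums become
    binomial convolutions, so bounds of the form [exp] multiply over independent summands. The
    dilution [kappa] produces the two regimes. At the orders used, sub-exponential moments exceed
    Gaussian ones by at most powers of [kappa], up to constants; enlarging the scale by [kappa]
    while dividing the probability of being switched on by [kappa] leaves second moments unchanged.
    Hence [kappa] stays out of the variance and enters only the smallness condition on
    [kappa * norm A]; there [r * kappa = r ^ (2 / alpha)] is the source of the exponent [alpha / 2].
    Orders are powers of two because every step halves the order and uses convexity of the power;
    the descent ends at order one, where the off-diagonal form has mean zero. The two groups of
    variables of a bipartite form are already independent, hence no copy. *)

Definition dp (k : nat) (x : R) : R := x ^+ k / k`!%:R.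

Lemma dp0 x : dp 0 x = 1.
Proof. by rewrite /dp expr0 fact0 divr1. Qed.

Lemma dp1 x : dp 1 x = x.
Proof. by rewrite /dp expr1 divr1. Qed.

Lemma dpS k x : dp k.+1 x = x * dp k x / k.+1%:R.
Proof.
by rewrite /dp exprS factS natrM invfM; ring.
Qed.

Lemma dp_ge0 k x : 0 <= x -> 0 <= dp k x.
Proof. by move=> x0; rewrite /dp divr_ge0// exprn_ge0. Qed.

Lemma dp_even_ge0 k x : 0 <= dp k.*2 x.
Proof. by rewrite /dp divr_ge0// -muln2 exprM sqr_ge0. Qed.

Lemma dpD n x y : dp n (x + y) = \sum_(k < n.+1) dp k y * dp (n - k) x.
Proof.
rewrite /dp exprDn mulr_suml; apply: eq_bigr => -[k /=]; rewrite ltnS => kn _.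
have h : ('C(n, k)%:R * (k`!%:R * (n - k)`!%:R) = n`!%:R :> R).
  by rewrite -!natrM bin_fact.
rewrite -mulr_natr -h; field.
by rewrite !pnatr_eq0 -!lt0n !fact_gt0 bin_gt0 kn.
Qed.

(** With [A = 2a + 1] and [B = 2b + 1], the difference is a nonnegative factor times a binary
    quadratic form in [x] and [y]: half the square of [(A+1) x - (B+1) y], plus multiples of [x^2]
    and [y^2] that are nonnegative because [A, B >= 1]. *)
Lemma dp_amgm a b x y :
  dp a.*2.+1 y * dp b.*2.+1 x <=
  dp a.*2 y * dp b.*2.+2 x + dp a.*2.+2 y * dp b.*2 x.
Proof.
rewrite !dpS.
have := dp_even_ge0 a y; have := dp_even_ge0 b x.
move: (dp a.*2 y) (dp b.*2 x) => P Q Q0 P0.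
rewrite -(natr1 a.*2.+1) -(natr1 b.*2.+1).
have : 1 <= a.*2.+1%:R :> R by rewrite ler1n.
have : 1 <= b.*2.+1%:R :> R by rewrite ler1n.
move: (a.*2.+1%:R) (b.*2.+1%:R) => A B B1 A1.
rewrite -subr_ge0.
have -> : P * (x * (x * Q / B) / (B + 1)) + y * (y * P / A) / (A + 1) * Q -
   y * P / A * (x * Q / B) = (P * Q) * ((A * (A+1) * x^+2 + B * (B+1) * y ^+ 2
     - (A+1) * (B+1) * x * y) / (A * B * (A+1) * (B+1))).
  by field; rewrite !gt_eqF//; lra.
apply: mulr_ge0; first exact: mulr_ge0.
apply: divr_ge0; last by rewrite !mulr_ge0//; lra.
rewrite (_ : _ - _ = 2^-1 * ((A+1) * x - (B+1)*y)^+2 +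
   2^-1 * ((A-1)*(A+1) * x^+2 + (B-1)*(B+1)*y^+2)); last by field.
have := sqr_ge0 ((A + 1) * x - (B + 1) * y).
have : 0 <= (A-1)*(A+1) * x^+2.
  by apply: mulr_ge0 (sqr_ge0 _); apply: mulr_ge0; lra.
have : 0 <= (B-1)*(B+1) * y^+2.
  by apply: mulr_ge0 (sqr_ge0 _); apply: mulr_ge0; lra.
lra.
Qed.

Lemma big_ord_parity (F : nat -> R) m :
  \sum_(k < m.*2.+1) F k = \sum_(l < m.+1) F l.*2 + \sum_(l < m) F l.*2.+1.
Proof.
elim: m => [|m IH]; first by rewrite !big_ord1 big_ord0 addr0.
by rewrite doubleS 2!big_ord_recr IH [in RHS]big_ord_recr/= [X in _ = _ + X]big_ord_recr/= doubleS; ring.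
Qed.

(* The odd terms of degree at least three in the increment are absorbed into
   the neighbouring even ones, so that no symmetrization is needed. *)
Lemma dp_even_increment m x y :
  dp m.+1.*2 (x + y) <= dp m.+1.*2 x + y * dp m.*2.+1 x +
    3 * \sum_(l < m.+1) dp l.+1.*2 y * dp (m - l).*2 x.
Proof.
rewrite dpD (big_ord_parity (fun k => dp k y * dp (_ - k) x)).
rewrite big_ord_recl [X in _ + X <= _]big_ord_recl /= dp0 mul1r subn0 dp1.
have -> : (m.+1.*2 - 1 = m.*2.+1)%N by lia.
have e l : dp (bump 0 l).*2 y * dp (m.+1.*2 - (bump 0 l).*2) x =
   dp l.+1.*2 y * dp (m - l).*2 x.
  by rewrite /bump /= add1n doubleB !doubleS !subSS.
under eq_bigr do rewrite e.
set S := \sum_(l < m.+1) _.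
(* Each odd term is charged to its two even neighbours, so each even term is charged at most twice:
   [3 = 1 + 2]. The linear term is kept exact, to be killed by centring. *)
suff: \sum_(i < m) dp (bump 0 i).*2.+1 y * dp (m.+1.*2 - (bump 0 i).*2.+1) x <= S + S by lra.
have step : \sum_(i < m) dp (bump 0 i).*2.+1 y * dp (m.+1.*2 - (bump 0 i).*2.+1) x
  <= \sum_(i < m) (dp i.+1.*2 y * dp (m - i).*2 x
     + dp i.+2.*2 y * dp (m - i.+1).*2 x).
  apply: ler_sum => -[i /= im] _; rewrite /bump add1n.
  have -> : (m.+1.*2 - i.+1.*2.+1 = (m - i.+1).*2.+1)%N by lia.
  apply: (le_trans (dp_amgm _ _ _ _)).
  by rewrite (_ : (m - i.+1).*2.+2 = (m - i).*2)%N//; lia.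
apply: (le_trans step); rewrite big_split /=; apply: lerD.
  rewrite /S big_ord_recr /= lerDl mulr_ge0// ?dp_even_ge0//.
rewrite /S big_ord_recl/= [X in _ <= _ + X](eq_bigr (fun i : 'I_m => dp i.+2.*2 y * dp (m - i.+1).*2 x)) ?lerDr//.
by rewrite mulr_ge0// dp_even_ge0.
Qed.

End divided_powers.

(** * Elementary numerical inequalities *)

Section elementary_inequalities.
Context {R : realType}.
Implicit Types x y q : R.

(** Convexity of squaring, iterated: after the first squaring both sides are nonnegative, so they
    can be squared again whatever the signs of [x] and [y]. *)
Lemma convex_exp2 k q x y : 0 <= q <= 1 ->
  ((1 - q) * x + q * y) ^+ (2 ^ k) <=
  (1 - q) * x ^+ (2 ^ k) + q * y ^+ (2 ^ k).
Proof.
move=> /andP[q0 q1].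
have sqr (u v : R) : ((1 - q) * u + q * v) ^+ 2 <= (1 - q) * u ^+ 2 + q * v ^+ 2.
  rewrite -subr_ge0 (_ : _ - _ = q * (1 - q) * (u - v) ^+ 2); last by ring.
  by rewrite mulr_ge0 ?sqr_ge0// mulr_ge0// subr_ge0.
elim: k => [|k IH]; first by rewrite expn0 !expr1.
rewrite expnS mulnC !exprM.
have [->|k0] := posnP k; first by rewrite expn0 !expr1 sqr.
apply: (le_trans _ (sqr _ _)); rewrite ler_sqr ?nnegrE//.
  by case: (k) k0 => // k' _; rewrite expnS exprM exprn_ge0// sqr_ge0.
have ev (u : R) : 0 <= u ^+ (2 ^ k).
  by case: (k) k0 => // k' _; rewrite expnS exprM exprn_ge0// sqr_ge0.
by rewrite addr_ge0// mulr_ge0// subr_ge0.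
Qed.

Lemma dp_exp2D k x y :
  dp (2 ^ k) (x + y) <= 2^-1 * (dp (2 ^ k) (2 * x) + dp (2 ^ k) (2 * y)).
Proof.
rewrite /dp -mulrDl mulrA ler_wpM2r ?invr_ge0//.
have := @convex_exp2 k 2^-1 (2 * x) (2 * y).
rewrite (_ : (1 - 2^-1) * _ + _ = x + y); last by field.
by rewrite (_ : 1 - 2^-1 = 2^-1 :> R) ?mulrDr; [apply; lra | field].
Qed.

Lemma geometric_sum_le m y : 0 <= y -> y <= 2^-1 ->
  \sum_(l < m) y ^+ l.+1 <= 2 * y.
Proof.
move=> y0 y1; elim: m => [|m IH]; first by rewrite big_ord0 mulr_ge0.
rewrite big_ord_recl /= expr1.
under eq_bigr do rewrite /bump /= add1n exprS.
rewrite -mulr_sumr.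
have : y * \sum_(i < m) y ^+ i.+1 <= y * (2 * y) by rewrite ler_wpM2l.
have : y * (2 * y) <= y * 1 by rewrite ler_wpM2l//; lra.
lra.
Qed.

Lemma expR_le1D2 x : 0 <= x -> x <= 2^-1 -> expR x <= 1 + 2 * x.
Proof.
move=> x0 x1; have := expR_ge1Dx (- x); rewrite expRN => h.
rewrite -[expR x]invrK; apply: (@le_trans _ _ (1 - x)^-1).
  by rewrite lef_pV2// posrE ?invr_gt0 ?expR_gt0//; lra.
rewrite -[_^-1]mul1r ler_pdivrMr; last by lra.
have : x * x <= x * 2^-1 by rewrite ler_wpM2l.
lra.
Qed.

Lemma fact_double_le l : (l.*2`! <= 4 ^ l * l`! ^ 2)%N.
Proof.
elim: l => [//|l IH]; rewrite doubleS !factS.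
have -> : ((l.*2.+2) * (l.*2.+1 * (l.*2)`!) <= 4 ^ l.+1 * (l.+1 * l`!) ^ 2)%N =
  ((l.*2.+2) * (l.*2.+1 * (l.*2)`!) <= (4 * l.+1 ^ 2) * (4 ^ l * l`! ^ 2))%N.
  by congr (_ <= _)%N; rewrite expnS expnMn; ring.
rewrite mulnA leq_mul// expnS expn1 -muln2; lia.
Qed.

Lemma expn_fact_le l : (l ^ l * l`! <= l.*2`!)%N.
Proof.
have h k : (l ^ k * l`! <= (l + k)`!)%N.
  elim: k => [|k IH]; first by rewrite addn0 mul1n.
  by rewrite addnS factS expnS -mulnA leq_mul// leqW// leq_addr.
by rewrite -addnn.
Qed.

End elementary_inequalities.

(** * Random subsets with independent inclusions *)

Section random_subset.
Context {R : realType} {I : finType} (q : I -> R).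
Hypothesis q01 : forall i, 0 <= q i <= 1.

(* The expectation of [F V], where the random subset [V] of [s] contains each
   [i] independently with probability [q i]. *)
Fixpoint ber (s : seq I) (F : {set I} -> R) : R :=
  if s is i :: s' then
    (1 - q i) * ber s' F + q i * ber s' (fun V => F (i |: V))
  else F finset.set0.

(** Comparing on subsets of [s] only makes facts such as [i \notin V] available in inductions on
    [s]. *)
Lemma ber_le s F G : (forall V : {set I}, V \subset s -> F V <= G V) ->
  ber s F <= ber s G.
Proof.
elim: s F G => [|i s IH] F G h /=; first by apply: h; apply/fintype.subsetP => j; rewrite inE.
have /andP[q0 q1] := q01 i; apply: lerD; apply: ler_wpM2l => //.
- by rewrite subr_ge0.
- apply: IH => V /fintype.subsetP Vs; apply: h; apply/fintype.subsetP => j /Vs.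
  by rewrite inE orbC => ->.
- apply: IH => V /fintype.subsetP Vs; apply: h; apply/fintype.subsetP => j.
  by rewrite !inE => /orP[->//|/Vs ->]; rewrite orbT.
Qed.

Lemma ber_eq s F G : (forall V : {set I}, V \subset s -> F V = G V) ->
  ber s F = ber s G.
Proof.
by move=> h; apply/le_anti/andP; split; apply: ber_le => V Vs; rewrite h.
Qed.

Lemma berD s F G : ber s (fun V => F V + G V) = ber s F + ber s G.
Proof. by elim: s F G => [//|i s IH] F G /=; rewrite !IH; ring. Qed.

Lemma berZ s a F : ber s (fun V => a * F V) = a * ber s F.
Proof. by elim: s F => [//|i s IH] F /=; rewrite !IH; ring. Qed.

Lemma ber_cst s a : ber s (fun=> a) = a.
Proof. by elim: s => [//|i s IH] /=; rewrite !IH; ring. Qed.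

Lemma ber_sum s (J : Type) (r : seq J) (F : J -> {set I} -> R) :
  ber s (fun V => \sum_(j <- r) F j V) = \sum_(j <- r) ber s (F j).
Proof.
elim: r => [|j r IH].
  by rewrite big_nil -[RHS](ber_cst s); apply: ber_eq => V _; rewrite big_nil.
rewrite big_cons -IH -berD; apply: ber_eq => V _; exact: big_cons.
Qed.

Lemma ber_jensen k s F : ber s F ^+ (2 ^ k) <= ber s (fun V => F V ^+ (2 ^ k)).
Proof.
elim: s F => [//|i s IH] F /=.
apply: (le_trans (convex_exp2 _ _ _ (q01 i))).
by have /andP[q0 q1] := q01 i; apply: lerD; apply: ler_wpM2l => //; rewrite subr_ge0.
Qed.

Lemma notin_subset (i : I) (s : seq I) (V : {set I}) : i \notin s -> V \subset s -> i \notin V.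
Proof. by move=> is_ /fintype.subsetP Vs; apply/negP => /Vs; exact/negP. Qed.

(** Inclusions are independent, so the exponential factorizes; each factor is
    [1 - q + q e^c <= 1 + 2 q c <= e^(2 q c)], by [c <= 1/2]. *)
Lemma ber_expR_le s (c : I -> R) : uniq s ->
  (forall i, 0 <= c i <= 2^-1) ->
  ber s (fun V => expR (\sum_(i in V) c i)) <= expR (\sum_(i <- s) 2 * q i * c i).
Proof.
move=> us hc; elim: s us => [_|i s IH /= /andP[is_ us]].
  by rewrite /= big_nil big_set0.
have -> : ber s (fun V => expR (\sum_(j in i |: V) c j)) =
          expR (c i) * ber s (fun V => expR (\sum_(j in V) c j)).
  rewrite -berZ; apply: ber_eq => V Vs.
  by rewrite big_setU1 ?(notin_subset is_)//= expRD.
rewrite big_cons expRD mulrA -mulrDl.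
have /andP[q0 q1] := q01 i; have /andP[c0 c1] := hc i.
apply: ler_pM => //; last exact: IH.
- by rewrite addr_ge0 ?mulr_ge0 ?subr_ge0// expR_ge0.
- rewrite -[leLHS](ber_cst s); apply: ber_le => V _; apply: expR_ge0.
- apply: le_trans (expR_ge1Dx _).
  have := ler_wpM2l q0 (expR_le1D2 c0 c1); lra.
Qed.

Lemma ber_notin s j : uniq s -> j \in s ->
  ber s (fun V => (j \notin V)%:R) = 1 - q j.
Proof.
elim: s => [//|i s IH /= /andP[is_ us]]; rewrite inE => /orP[/eqP ji|js].
  subst i.
  rewrite (@ber_eq _ _ (fun=> 1)); last by move=> V /(notin_subset is_) ->.
  rewrite (@ber_eq s (fun V => (_ \notin _)%:R) (fun=> 0)); last first.
    by move=> V _; rewrite !inE eqxx.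
  by rewrite !ber_cst; ring.
rewrite IH// (@ber_eq s _ (fun V => (j \notin V)%:R)) ?IH//; first by ring.
move=> V _; rewrite !inE; case: eqP => // ji; subst i.
by rewrite js in is_.
Qed.

Lemma ber_in s i : uniq s -> i \in s -> ber s (fun V => (i \in V)%:R) = q i.
Proof.
move=> us is_; rewrite (_ : q i = 1 - (1 - q i)); last by ring.
rewrite -(ber_notin us is_) -[X in X - _](ber_cst s 1).
rewrite -[X in _ = _ + X]mulN1r -berZ -berD; apply: ber_eq => V _.
by case: (i \in V) => /=; rewrite ?mulr0 ?mulr1 ?addr0 ?subrr.
Qed.

Lemma ber_in_notin s i j : uniq s -> i \in s -> j \in s -> i != j ->
  ber s (fun V => (i \in V)%:R * (j \notin V)%:R) = q i * (1 - q j).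
Proof.
elim: s => [//|k s IH /= /andP[ks us]]; rewrite !inE => /predU1P ik /predU1P jk ij.
have [eik|nik] := eqVneq i k.
  subst k; case: jk => [eji|js]; first by rewrite eji eqxx in ij.
  rewrite (@ber_eq _ _ (fun=> 0)); last first.
    by move=> V /(notin_subset ks)/negbTE ->; rewrite mul0r.
  rewrite ber_cst (@ber_eq s _ (fun V => (j \notin V)%:R)) ?ber_notin//; first ring.
  by move=> V _; rewrite !inE eqxx mul1r eq_sym (negbTE ij).
case: ik => [/eqP|is_]; first by rewrite (negbTE nik).
have [ejk|njk] := eqVneq j k.
  subst k.
  rewrite (@ber_eq _ _ (fun V => (i \in V)%:R)); last first.
    by move=> V /(notin_subset ks) ->; rewrite mulr1.
  rewrite ber_in// (@ber_eq s _ (fun=> 0)) ?ber_cst//; first ring.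
  by move=> V _; rewrite !inE eqxx mulr0.
case: jk => [/eqP|js]; first by rewrite (negbTE njk).
rewrite IH// (@ber_eq s _ (fun V => (i \in V)%:R * (j \notin V)%:R)) ?IH//; first ring.
by move=> V _; rewrite !inE (negbTE nik) (negbTE njk).
Qed.

End random_subset.

(** * Expectation of polynomials in independent variables *)

Section polynomial_expectation.
Context {R : realType} {T : Type} {I : finType}.
Variable x : I -> T -> R.

(* Polynomials in the variables [x j], [j \in J]. *)
Inductive pol (J : {set I}) : (T -> R) -> Prop :=
| pol_mon c (k : I -> nat) : pol J (fun w => c * \prod_(j in J) x j w ^+ k j)
| pol_add f g : pol J f -> pol J g -> pol J (fun w => f w + g w).

Lemma pol_eq J f g : f =1 g -> pol J f -> pol J g.
Proof. by move=> fg; rewrite (_ : g = f) //; apply/funext => w; rewrite fg. Qed.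

Lemma pol_cst J c : pol J (fun=> c).
Proof.
apply: pol_eq (pol_mon J c (fun=> 0%N)) => w.
by rewrite big1 ?mulr1// => i _; rewrite expr0.
Qed.

Lemma pol_var (J : {set I}) i : i \in J -> pol J (x i).
Proof.
move=> iJ; apply: pol_eq (pol_mon J 1 (fun j => (j == i)%N)) => w.
rewrite mul1r (bigD1 i)//= eqxx expr1 big1 ?mulr1// => j /andP[_ /negbTE ->].
by rewrite expr0.
Qed.

Lemma polM J f g : pol J f -> pol J g -> pol J (fun w => f w * g w).
Proof.
elim=> [c k|f1 f2 _ IH1 _ IH2] pg; last first.
  by apply: pol_eq (pol_add (IH1 pg) (IH2 pg)) => w; rewrite mulrDl.
elim: pg => [c' k'|g1 g2 _ IH1 _ IH2]; last first.
  by apply: pol_eq (pol_add IH1 IH2) => w; rewrite mulrDr.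
apply: pol_eq (pol_mon J (c * c') (fun j => k j + k' j)%N) => w.
under eq_bigr do rewrite exprD.
by rewrite big_split /=; ring.
Qed.

Lemma polZ J c f : pol J f -> pol J (fun w => c * f w).
Proof. exact/polM/pol_cst. Qed.

Lemma polX J f k : pol J f -> pol J (fun w => f w ^+ k).
Proof.
move=> pf; elim: k => [|k IH]; first exact: pol_cst.
by apply: pol_eq (polM pf IH) => w; rewrite exprS.
Qed.

Lemma pol_dp J f k : pol J f -> pol J (fun w => dp k (f w)).
Proof. by move=> pf; apply: polM (pol_cst _ _); exact: polX. Qed.

Lemma pol_sum J (K : Type) (r : seq K) (P : pred K) (f : K -> T -> R) :
  (forall k, P k -> pol J (f k)) -> pol J (fun w => \sum_(k <- r | P k) f k w).
Proof.
move=> pf; elim: r => [|k r IH].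
  by apply: pol_eq (pol_cst _ 0) => w; rewrite big_nil.
case Pk : (P k); last by apply: pol_eq IH => w; rewrite big_cons Pk.
by apply: pol_eq (pol_add (pf _ Pk) IH) => w; rewrite big_cons Pk.
Qed.

Lemma pol_subset (J J' : {set I}) f : J \subset J' -> pol J f -> pol J' f.
Proof.
move=> /fintype.subsetP JJ'; elim=> [c k|f1 f2 _ IH1 _ IH2]; last exact: pol_add.
apply: polZ; rewrite (_ : (fun w => _) =
  fun w => \prod_(j in J') x j w ^+ (if j \in J then k j else 0%N)).
  apply: pol_eq (pol_mon J' 1 (fun j => if j \in J then k j else 0%N)) => w.
  by rewrite mul1r.
apply/funext => w; rewrite [LHS]big_mkcond [RHS]big_mkcond; apply: eq_bigr => j _.
by case: ifPn => [/JJ' ->//|_]; case: ifP.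
Qed.

(** All that the moment bounds use about expectation: linearity and monotonicity on polynomials, and
    independence in the form [mf_prod]. Integrability is thus settled once, when the functional is
    constructed. *)
Record moment_functional (E : (T -> R) -> R) : Prop := MomentFunctional {
  mf_cst : forall c, E (fun=> c) = c;
  mf_add : forall f g, pol [set: I] f -> pol [set: I] g ->
    E (fun w => f w + g w) = E f + E g;
  mf_scale : forall c f, pol [set: I] f -> E (fun w => c * f w) = c * E f;
  mf_le : forall f g, pol [set: I] f -> pol [set: I] g ->
    (forall w, f w <= g w) -> E f <= E g;
  mf_prod : forall k : I -> nat, E (fun w => \prod_j x j w ^+ k j) =
    \prod_j E (fun w => x j w ^+ k j)
}.

Variables (E : (T -> R) -> R) (mE : moment_functional E).

Lemma polT J f : pol J f -> pol [set: I] f.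
Proof. exact/pol_subset/finset.subsetT. Qed.
Hint Resolve pol_cst polM polZ polX pol_dp pol_sum pol_add polT : core.

Lemma mf_eq f g : f =1 g -> E f = E g.
Proof. by move=> fg; congr E; apply/funext. Qed.

Lemma mf_sum (K : Type) (r : seq K) (P : pred K) (f : K -> T -> R) :
  (forall k, P k -> pol [set: I] (f k)) ->
  E (fun w => \sum_(k <- r | P k) f k w) = \sum_(k <- r | P k) E (f k).
Proof.
move=> pf; elim: r => [|k r IH].
  by rewrite big_nil -[RHS](mf_cst mE); apply: mf_eq => w; rewrite big_nil.
rewrite big_cons; case Pk : (P k); last first.
  by rewrite -IH; apply: mf_eq => w; rewrite big_cons Pk.
rewrite -IH -(mf_add mE); [|exact: pf|exact: pol_sum].
by apply: mf_eq => w; rewrite big_cons Pk.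
Qed.

Lemma mf_ge0 f : pol [set: I] f -> (forall w, 0 <= f w) -> 0 <= E f.
Proof.
by move=> pf f0; rewrite -[leLHS](mf_cst mE); apply: (mf_le mE).
Qed.

Lemma mf_prod_in (J : {set I}) (k : I -> nat) :
  E (fun w => \prod_(j in J) x j w ^+ k j) =
  \prod_(j in J) E (fun w => x j w ^+ k j).
Proof.
pose k' j := if j \in J then k j else 0%N.
transitivity (E (fun w => \prod_j x j w ^+ k' j)).
  apply: mf_eq => w; rewrite big_mkcond; apply: eq_bigr => j _.
  by rewrite /k'; case: ifP.
rewrite (mf_prod mE) [RHS]big_mkcond; apply: eq_bigr => j _.
by rewrite /k'; case: ifP => // _; under eq_fun do rewrite expr0; exact: mf_cst.
Qed.

Lemma prod_setU (J J' : {set I}) (F : I -> R) : [disjoint J & J'] ->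
  \prod_(j in J :|: J') F j = (\prod_(j in J) F j) * \prod_(j in J') F j.
Proof. by move=> dJ; rewrite -bigU//; apply: eq_bigl => j; rewrite !inE. Qed.

(** Bilinearity reduces this to monomials; over disjoint index sets their product is again one
    monomial, which the product rule splits index by index. *)
Lemma mf_mul (J J' : {set I}) f g : [disjoint J & J'] -> pol J f -> pol J' g ->
  E (fun w => f w * g w) = E f * E g.
Proof.
move=> dJ; elim=> [c k|f1 f2 p1 IH1 p2 IH2] pg; last first.
  transitivity (E (fun w => f1 w * g w + f2 w * g w)).
    by apply: mf_eq => w; rewrite mulrDl.
  rewrite !(mf_add mE) ?IH1 ?IH2//; first (by ring); eauto.
elim: pg => [c' k'|g1 g2 p1 IH1 p2 IH2]; last first.
  set h := fun w : T => c * _.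
  transitivity (E (fun w => h w * g1 w + h w * g2 w)).
    by apply: mf_eq => w; rewrite mulrDr.
  have ph : pol [set: I] h by apply: polT (pol_mon _ _ _).
  by rewrite !(mf_add mE) ?IH1 ?IH2//; first (by ring); eauto.
have pm (K : {set I}) l : pol [set: I] (fun w => \prod_(j in K) x j w ^+ l j).
  by apply: pol_eq (polT (pol_mon K 1 l)) => w; rewrite mul1r.
rewrite !(mf_scale mE)// !mf_prod_in.
pose k2 j := if j \in J then k j else k' j.
transitivity (E (fun w => (c * c') * \prod_(j in J :|: J') x j w ^+ k2 j)).
  apply: mf_eq => w /=; rewrite prod_setU// mulrACA; congr (_ * (_ * _)); apply: eq_bigr => j jJ.
    by rewrite /k2 jJ.
  by rewrite /k2 (disjointFl dJ jJ).
rewrite (mf_scale mE)// mf_prod_in prod_setU// [RHS]mulrACA.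
congr (_ * (_ * _)); apply: eq_bigr => j jJ; first by rewrite /k2 jJ.
by rewrite /k2 (disjointFl dJ jJ).
Qed.

End polynomial_expectation.

(** * Moments of sparse sums *)

Section sparse_moments.
Context {R : realType} {T : Type} {I : finType}.
Variables (x : I -> T -> R) (E : (T -> R) -> R).
Hypothesis mE : moment_functional x E.
Variables (p : I -> R) (C kappa : R) (N : nat).
Hypothesis p01 : forall i, 0 <= p i <= 1.
Hypothesis C1 : 1 <= C.
Hypothesis kappa1 : 1 <= kappa.
Hypothesis x_centered : forall i, E (x i) = 0.
(** The factor [(2l)! / l!] is [2^l] times the Gaussian moment of order [2l]. Natural subtraction
    makes [kappa] absent for [l = 1] and [l = 2]: second and fourth moments are free of it, which
    keeps it out of both variance terms. The cutoff [N] is there because [kappa] will depend on the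
    order considered. *)
Hypothesis x_moments : forall i l, (0 < l <= N)%N ->
  E (fun w => x i w ^+ l.*2) <=
    p i * C ^+ l * kappa ^+ (l - 2) * (l.*2`!%:R / l`!%:R).

(** One factor [kappa] moves from the scale into the probability: [p kappa^(l-1) = q kappa^l]. The
    [3] in [c] is that of [dp_even_increment], absorbed through [3 <= 3^l]. *)
Let q i := p i / kappa.
Let c := 3 * C * kappa.

Let C_gt0 : 0 < C. Proof. exact: lt_le_trans C1. Qed.
Let kappa_gt0 : 0 < kappa. Proof. exact: lt_le_trans kappa1. Qed.
Let c_gt0 : 0 < c. Proof. by rewrite !mulr_gt0. Qed.

Let q01 i : 0 <= q i <= 1.
Proof.
have /andP[p0 p1] := p01 i; rewrite /q divr_ge0 ?(ltW kappa_gt0)//=.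
by rewrite ler_pdivrMr// mul1r (le_trans p1).
Qed.

Ltac pol_auto := repeat (try assumption; lazymatch goal with
  | |- pol _ _ (fun _ => ?a) => exact: pol_cst
  | |- pol _ _ (fun w => dp ?k (@?f w)) => apply: (@pol_dp _ _ _ _ _ f k)
  | |- pol _ _ (fun w => @?f w ^+ ?k) => apply: (@polX _ _ _ _ _ f k)
  | |- pol _ _ (fun w => @?f w + @?g w) => apply: (@pol_add _ _ _ _ _ f g)
  | |- pol _ _ (fun w => @?f w * @?g w) => apply: (@polM _ _ _ _ _ f g)
  | |- pol _ _ (fun w => \sum_(_ <- _ | _) _) => apply: pol_sum => ? ?
  | |- pol _ _ ?F => progress unfold F
  end).

Lemma x_moments_dp i l : (0 < l <= N)%N ->
  3 * (E (fun w => x i w ^+ l.*2) / l.*2`!%:R) <= q i * (c ^+ l / l`!%:R).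
Proof.
move=> /andP[l0 lN].
have f0 k : 0 < k`!%:R :> R by rewrite ltr0n fact_gt0.
have /andP[p0 _] := p01 i.
have h : kappa ^+ (l - 2) <= kappa ^+ l / kappa.
  rewrite ler_pdivlMr// -exprSr; apply: ler_weXn2l => //.
  by case: (l) l0 => // l' _; lia.
have h3 : 3 <= 3 ^+ l :> R.
  by rewrite -[leLHS]expr1; apply: ler_weXn2l => //; rewrite ler1n.
apply: (@le_trans _ _ (3 * (p i * C ^+ l * kappa ^+ (l - 2) / l`!%:R))).
  rewrite ler_pM2l// ler_pdivrMr//.
  apply: le_trans (x_moments i _) _; first by rewrite l0.
  by rewrite le_eqVlt; apply/orP; left; apply/eqP; field; rewrite gt_eqF.
rewrite mulrA [leRHS]mulrA ler_wpM2r ?invr_ge0//.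
rewrite /q /c !exprMn.
rewrite (_ : _ / _ * _ = (3 ^+ l * (p i * C ^+ l)) * (kappa ^+ l / kappa)); last by ring.
rewrite [leLHS]mulrA; apply: ler_pM => //.
- by rewrite mulr_ge0// mulr_ge0// exprn_ge0// ltW.
- by rewrite exprn_ge0// ltW.
- by rewrite ler_wpM2r// mulr_ge0// exprn_ge0// ltW.
Qed.

Lemma mf_mul_indep (J : {set I}) i f g : i \notin J -> pol x J f ->
  pol x [set i]%SET g -> E (fun w => f w * g w) = E f * E g.
Proof.
move=> iJ pf pg; apply: (mf_mul mE _ pf pg).
by rewrite disjoint_sym disjoints1.
Qed.

Lemma mf_mul1 (J : {set I}) i f k : i \notin J -> pol x J f ->
  E (fun w => f w * x i w ^+ k) = E f * E (fun w => x i w ^+ k).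
Proof.
by move=> iJ pf; apply: (mf_mul_indep iJ) => //; apply/polX/pol_var; rewrite inE.
Qed.

(** The [x i] are integrated out one at a time. The linear term vanishes by centring; the even terms
    are at most [q i] times the terms of positive degree in the expansion of [dp m] at the increment
    [c * b i ^ 2]. This is the effect of letting [i] join [V] with probability [q i], and the order
    has dropped from [2m] to [m]. *)
Lemma linear_form_moment (s : seq I) (J : {set I}) (b : I -> T -> R) H m :
  uniq s -> (forall i, i \in s -> i \notin J) -> (forall i, pol x J (b i)) ->
  pol x J H -> (forall w, 0 <= H w) -> (m <= N)%N ->
  E (fun w => H w * dp m.*2 (\sum_(i <- s) b i w * x i w)) <=
  ber q s (fun V => E (fun w => H w * dp m (c * \sum_(i in V) b i w ^+ 2))).
Proof.
move=> us sJ pb; elim: s us sJ H m => [_ _|i s IH /= /andP[is_ us] sJ] H m pH H0 mN.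
  rewrite /= le_eqVlt; apply/orP; left; apply/eqP; apply: mf_eq => w.
  rewrite big_nil big_set0 mulr0; case: (m) => [|m']; first by rewrite !dp0.
  by rewrite doubleS !dpS !mul0r.
have sJ' j : j \in s -> j \notin J by move=> js; apply: sJ; rewrite inE js orbT.
have iJ : i \notin J by apply: sJ; rewrite inE eqxx.
pose J2 := J :|: [set j in s].
have iJ2 : i \notin J2 by rewrite !inE negb_or iJ.
have JJ2 : J \subset J2 by apply: finset.subsetUl.
have subJ f : pol x J f -> pol x J2 f by apply: pol_subset.
pose X w := \sum_(j <- s) b j w * x j w.
have pX : pol x J2 X.
  rewrite /X; under eq_fun do rewrite big_seq_cond; apply: pol_sum => j /andP[js _].
  by apply: polM; [exact: subJ|apply: pol_var; rewrite !inE js orbT].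
have pxi : pol x [set: I] (x i) by apply: pol_var; rewrite inE.
have pTJ f : pol x J f -> pol x [set: I] f by apply: polT.
have pTJ2 f : pol x J2 f -> pol x [set: I] f by apply: polT.
have pbi := pb i.
case: m mN => [_|m mN].
  have E0 (z : T -> R) : E (fun w => H w * dp 0 (z w)) = E H.
    by apply: mf_eq => w; rewrite dp0 mulr1.
  by rewrite E0 !ber_cst -mulrDl subrK mul1r.
(* The weight absorbs the even powers of [b i], which keep it nonnegative: this is why the induction
   runs over an arbitrary [H]. *)
pose G l w := H w * b i w ^+ l.*2.
have pG l : pol x J (G l) by rewrite /G; pol_auto.
have G0 l w : 0 <= G l w by rewrite mulr_ge0// -muln2 exprM sqr_ge0.
pose Z (V : {set I}) w := c * \sum_(j in V) b j w ^+ 2.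
have pZ V : pol x J (Z V) by rewrite /Z; pol_auto.
have lhs : E (fun w => H w * dp m.+1.*2 (\sum_(j <- i :: s) b j w * x j w)) <=
   E (fun w => H w * dp m.+1.*2 (X w)) + E (fun w => H w * b i w * dp m.*2.+1 (X w)) * E (x i)
   + \sum_(l < m.+1) 3 * (E (fun w => x i w ^+ l.+1.*2) / l.+1.*2`!%:R) *
      E (fun w => G l.+1 w * dp (m - l).*2 (X w)).
  pose F1 w := H w * dp m.+1.*2 (X w).
  pose F2 w := (H w * b i w * dp m.*2.+1 (X w)) * x i w ^+ 1.
  pose F3 (l : nat) w := (G l.+1 w * dp (m - l).*2 (X w)) * x i w ^+ l.+1.*2.
  pose a l : R := 3 / l.+1.*2`!%:R.
  have p1 : pol x [set: I] F1 by apply: pTJ2; pol_auto; exact: subJ.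
  have p2 : pol x [set: I] F2.
    by apply: polM; [apply: pTJ2; pol_auto; exact: subJ | pol_auto].
  have p3 l : pol x [set: I] (F3 l).
    by apply: polM; [apply: pTJ2; pol_auto; exact: subJ | pol_auto].
  have -> : E (fun w => H w * dp m.+1.*2 (X w)) + E (fun w => H w * b i w * dp m.*2.+1 (X w)) * E (x i)
   + \sum_(l < m.+1) 3 * (E (fun w => x i w ^+ l.+1.*2) / l.+1.*2`!%:R) *
      E (fun w => G l.+1 w * dp (m - l).*2 (X w)) =
    E (fun w => (F1 w + F2 w) + \sum_(l < m.+1) a l * F3 l w).
    rewrite (mf_add mE); [|by pol_auto|by apply: pol_sum => l _; apply: polZ].
    rewrite (mf_add mE)//; congr (_ + _ + _).
      rewrite (mf_mul1 _ iJ2); last by pol_auto; exact: subJ.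
      by congr (_ * _); apply: mf_eq => w; rewrite expr1.
    rewrite (mf_sum mE); last by move=> l _; apply: polZ.
    apply: eq_bigr => l _; rewrite (mf_scale mE)// (mf_mul1 _ iJ2); last first.
      by pol_auto; exact: subJ.
    by rewrite /a; ring.
  apply: (mf_le mE).
  - apply: polM; first exact: pTJ.
    by apply: pol_dp; apply: pol_sum => j _; apply: polM; [exact: pTJ|apply: pol_var; rewrite inE].
  - by apply: pol_add; [pol_auto|apply: pol_sum => l _; apply: polZ].
  move=> w; rewrite big_cons -/(X w) addrC.
  apply: le_trans (ler_wpM2l (H0 w) (dp_even_increment _ _ _)) _.
  rewrite !mulrDr /F1 /F2 expr1 le_eqVlt; apply/orP; left; apply/eqP.
  congr (_ + _ + _); first by ring.
  rewrite mulrA mulr_sumr; apply: eq_bigr => l _.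
  by rewrite /F3 /a /G /dp exprMn; ring.
apply: (le_trans lhs); rewrite x_centered mulr0 addr0.
pose B (f : T -> R) k := ber q s (fun V => E (fun w => f w * dp k (Z V w))).
have hq : 0 <= q i by case/andP: (q01 i).
have step : \sum_(l < m.+1) 3 * (E (fun w => x i w ^+ l.+1.*2) / l.+1.*2`!%:R) *
      E (fun w => G l.+1 w * dp (m - l).*2 (X w)) <=
    \sum_(l < m.+1) q i * (c ^+ l.+1 / l.+1`!%:R) * B (G l.+1) (m - l)%N.
  apply: ler_sum => -[l /= lm] _; apply: ler_pM.
  - rewrite mulr_ge0// divr_ge0//; apply: (mf_ge0 mE); first by pol_auto.
    by move=> w; rewrite -muln2 exprM sqr_ge0.
  - apply: (mf_ge0 mE); first by apply: pTJ2; pol_auto; exact: subJ.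
    by move=> w; rewrite mulr_ge0// dp_even_ge0.
  - by apply: x_moments_dp; exact: leq_trans lm mN.
  - by apply: IH => //; exact: leq_trans (leq_subr _ _) (ltnW mN).
apply: (le_trans (lerD (IH us sJ' H m.+1 pH H0 mN) step)).
(* When [i] joins [V], the term of degree zero in the increment reproduces the case where it does
   not, so on that term the weights [1 - q i] and [q i] add up to one. *)
have -> : ber q s (fun V => E (fun w => H w * dp m.+1 (c * \sum_(j in i |: V) b j w ^+ 2)))
   = B H m.+1 + \sum_(l < m.+1) (c ^+ l.+1 / l.+1`!%:R) * B (G l.+1) (m - l)%N.
  under [X in _ + X]eq_bigr do rewrite -berZ.
  rewrite -(ber_sum q01) -berD; apply: (ber_eq q01) => V Vs.
  transitivity (E (fun w => H w * dp m.+1 (Z V w) + \sum_(l < m.+1)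
     (c ^+ l.+1 / l.+1`!%:R) * (G l.+1 w * dp (m - l) (Z V w)))); last first.
    have pGl l k : pol x [set: I] (fun w => G l w * dp k (Z V w)).
      by apply: pTJ; pol_auto.
    rewrite (mf_add mE); last 2 first.
      by apply: pTJ; pol_auto.
      by apply: pol_sum => l _; apply: polZ.
    rewrite (mf_sum mE); last by move=> l _; apply: polZ.
    by under eq_bigr do rewrite (mf_scale mE) //.
  apply: mf_eq => w; rewrite big_setU1 ?(notin_subset is_)//= mulrDr addrC -/(Z V w).
  rewrite dpD big_ord_recl dp0 mul1r subn0 mulrDr; congr (_ + _).
  rewrite mulr_sumr; apply: eq_bigr => l _.
  by rewrite lift0 subSS /G /dp exprMn -exprM mul2n; ring.
rewrite -/(Z _ _) -/(B _ _) mulrDr addrA -mulrDl subrK mul1r lerD2l mulr_sumr.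
by apply: ler_sum => l _; rewrite -mulrA.
Qed.

(** The central binomial bound [(2l)! <= 4^l l!^2] replaces [(2l)! / l!] by [l!]: squares of
    variables of Gaussian type are of exponential type. *)
Lemma square_moment i l : (0 < l <= N)%N ->
  E (fun w => x i w ^+ l.*2) / l`!%:R <= q i * (4 * c) ^+ l.
Proof.
move=> lN; have := x_moments_dp i lN.
have /andP[q0 _] := q01 i.
have f0 k : 0 < k`!%:R :> R by rewrite ltr0n fact_gt0.
have e0 : 0 <= E (fun w => x i w ^+ l.*2).
  apply: (mf_ge0 mE) => [|w]; last by rewrite -muln2 exprM sqr_ge0.
  by apply/polX/pol_var; rewrite inE.
move: (E _) e0 => e e0 h.
have h1 : e <= q i * (c ^+ l / l`!%:R) * l.*2`!%:R.
  rewrite -ler_pdivrMr//; apply: le_trans h.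
  by rewrite ler_peMl ?ler1n// divr_ge0.
rewrite ler_pdivrMr//; apply: (le_trans h1).
rewrite (_ : _ * l`!%:R = q i * (c ^+ l / l`!%:R) * (4 ^ l * l`! ^ 2)%:R).
  rewrite ler_wpM2l ?ler_nat ?fact_double_le// mulr_ge0// divr_ge0// exprn_ge0//.
  exact: ltW.
by rewrite natrM !natrX exprMn; field; rewrite gt_eqF.
Qed.

(** Splitting off one variable multiplies the bound by one plus [q i] times a geometric series of
    ratio [4 c g i <= 1/2], hence by at most [exp (8 c g i q i)]. *)
Lemma weighted_square_moment (s : seq I) (g : I -> R) m :
  uniq s -> (forall i, 0 <= g i) -> (forall i, 4 * c * g i <= 2^-1) ->
  (m <= N)%N ->
  E (fun w => dp m (\sum_(i <- s) g i * x i w ^+ 2)) <=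
  expR (\sum_(i <- s) 8 * c * g i * q i).
Proof.
move=> us g0 gs; elim: s us m => [_ m _|i s IH /= /andP[is_ us] m mN].
  rewrite big_nil expR0 (mf_eq E (g := fun=> dp m 0)); last first.
    by move=> w; rewrite big_nil.
  rewrite (mf_cst mE); case: m => [|m]; rewrite ?dp0// dpS !mul0r ler01//.
pose J := [set j in s]; have iJ : i \notin J by rewrite inE.
pose X w := \sum_(j <- s) g j * x j w ^+ 2.
have pX : pol x J X.
  rewrite /X; under eq_fun do rewrite big_seq_cond; apply: pol_sum => j /andP[js _].
  by apply/polZ/polX/pol_var; rewrite inE.
pose B := expR (\sum_(j <- s) 8 * c * g j * q j).
have IHm k : (k <= m)%N -> E (fun w => dp k (X w)) <= B.
  by move=> km; apply: IH => //; exact: leq_trans km mN.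
have pxi : pol x [set: I] (x i) by apply: pol_var; rewrite inE.
have pTX : pol x [set: I] X by apply: polT pX.
have e : E (fun w => dp m (\sum_(j <- i :: s) g j * x j w ^+ 2)) =
  E (fun w => dp m (X w)) + \sum_(l < m)
    (g i ^+ l.+1 * (E (fun w => x i w ^+ l.+1.*2) / l.+1`!%:R)) * E (fun w => dp (m - l.+1) (X w)).
  transitivity (E (fun w => dp m (X w) + \sum_(l < m) (g i ^+ l.+1 / l.+1`!%:R) *
     (dp (m - l.+1) (X w) * x i w ^+ l.+1.*2))).
    apply: mf_eq => w; rewrite big_cons addrC -/(X w) dpD big_ord_recl dp0 mul1r subn0.
    congr (_ + _); apply: eq_bigr => l _.
    by rewrite lift0 /dp exprMn -exprM mul2n; ring.
  have pl (l : 'I_m) : pol x [set: I] (fun w => dp (m - l.+1) (X w) * x i w ^+ l.+1.*2).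
    by pol_auto.
  rewrite (mf_add mE); [|by pol_auto|by apply: pol_sum => l _; apply: polZ].
  congr (_ + _); rewrite (mf_sum mE); last by move=> l _; apply: polZ.
  apply: eq_bigr => l _; rewrite (mf_scale mE)// (mf_mul1 _ iJ); last by pol_auto.
  by ring.
have B0 : 0 <= B := expR_ge0 _.
have /andP[q0 _] := q01 i.
rewrite e big_cons expRD -/B.
have h : \sum_(l < m) (g i ^+ l.+1 * (E (fun w => x i w ^+ l.+1.*2) / l.+1`!%:R)) * E (fun w => dp (m - l.+1) (X w))
   <= \sum_(l < m) q i * B * (4 * c * g i) ^+ l.+1.
  apply: ler_sum => -[l /= lm] _.
  rewrite [leRHS](_ : _ = (g i ^+ l.+1 * (q i * (4 * c) ^+ l.+1)) * B); last first.
    by rewrite !exprMn; ring.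
  apply: ler_pM.
  - rewrite mulr_ge0 ?exprn_ge0// divr_ge0//; apply: (mf_ge0 mE); first by pol_auto.
    by move=> w; rewrite -muln2 exprM sqr_ge0.
  - apply: (mf_ge0 mE); first by pol_auto.
    move=> w; apply: dp_ge0; apply: sumr_ge0 => j _; rewrite mulr_ge0// sqr_ge0//.
  - by rewrite ler_wpM2l ?exprn_ge0//; apply: square_moment; exact: leq_trans lm mN.
  - by apply: IHm; exact: leq_subr.
apply: (le_trans (lerD (IHm _ (leqnn m)) h)).
rewrite -mulr_sumr.
rewrite (_ : _ + _ = (1 + q i * \sum_(l < m) (4 * c * g i) ^+ l.+1) * B); last by ring.
rewrite ler_wpM2r//; apply: le_trans (expR_ge1Dx _).
rewrite lerD2l (mulrC _ (q i)) ler_wpM2l//.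
apply: (le_trans (geometric_sum_le _ _ (gs i))); last first.
  by rewrite le_eqVlt; apply/orP; left; apply/eqP; ring.
by rewrite !mulr_ge0// ltW.
Qed.

Let v i := E (fun w => x i w ^+ 2).
Let eta i w := x i w ^+ 2 - v i.

Let pol_eta (J : {set I}) i : i \in J -> pol x J (eta i).
Proof.
by move=> iJ; apply: pol_add (pol_cst _ _ _); apply/polX/pol_var.
Qed.

(** For [u, v >= 0], [|u - v|^(2l) <= u^(2l) + v^(2l)]. Moments of [x i] of order [4l >= 4] enter,
    and there two factors [kappa] are saved: hence the division by [kappa ^ 2]. *)
Lemma centered_square_moment i l : (0 < l)%N -> (l.*2 <= N)%N ->
  E (fun w => eta i w ^+ l.*2) <=
    p i / kappa ^+ 2 * (8 * C * kappa) ^+ l.*2 * l.*2`!%:R.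
Proof.
move=> l0 lN; have /andP[p0 p1] := p01 i.
have v0 : 0 <= v i.
  apply: (mf_ge0 mE) => [|w]; last exact: sqr_ge0.
  by apply/polX/pol_var; rewrite inE.
have vle : v i <= p i * (2 * C).
  have := @x_moments i 1; rewrite (_ : (1 - 2)%N = 0%N)// expr0 expr1 mulr1.
  rewrite (_ : 1.*2`! = 2%N)// (_ : 1`! = 1%N)// divr1 => /(_ _)/le_trans; apply.
    by rewrite (leq_trans _ lN)// -addnn; case: (l) l0.
  by rewrite le_eqVlt; apply/orP; left; apply/eqP; ring.
have point w : eta i w ^+ l.*2 <= x i w ^+ l.*2.*2 + v i ^+ l.*2.
  have u0 : 0 <= x i w ^+ 2 := sqr_ge0 _.
  rewrite (_ : x i w ^+ l.*2.*2 = (x i w ^+ 2) ^+ l.*2); last by rewrite -exprM mul2n.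
  have ev (z : R) : z ^+ l.*2 = `|z| ^+ l.*2.
    by rewrite -muln2 mulnC !exprM real_normK ?num_real.
  rewrite /eta ev; case: (lerP (v i) (x i w ^+ 2)) => h.
    rewrite -[leLHS]addr0; apply: lerD; last exact: exprn_ge0.
    by apply: lerXn2r; rewrite ?nnegrE ?normr_ge0//; lra.
  rewrite -[leLHS]add0r; apply: lerD; first exact: exprn_ge0.
  by apply: lerXn2r; rewrite ?nnegrE ?normr_ge0//; lra.
have pxi : pol x [set: I] (x i) by apply: pol_var; rewrite inE.
have le1 : E (fun w => eta i w ^+ l.*2) <=
    E (fun w => x i w ^+ l.*2.*2) + v i ^+ l.*2.
  rewrite -[X in _ + X](mf_cst mE) -(mf_add mE); [|by pol_auto|by pol_auto].
  apply: (mf_le mE) => //; last by pol_auto.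
  by apply/polX/pol_eta; rewrite inE.
apply: (le_trans le1).
have f0 k : 0 < k`!%:R :> R by rewrite ltr0n fact_gt0.
have f1 k : 1 <= k`!%:R :> R by rewrite ler1n fact_gt0.
have l2 : (0 < l.*2 <= N)%N by rewrite lN -addnn; case: (l) l0.
have kk : kappa ^+ (l.*2 - 2) = kappa ^+ l.*2 / kappa ^+ 2.
  have two_le : (2 <= l.*2)%N by case: (l) l0.
  by rewrite -[in RHS](subnK two_le) exprD mulfK// gt_eqF// exprn_gt0.
have bound1 : E (fun w => x i w ^+ l.*2.*2) <=
   p i * C ^+ l.*2 * (kappa ^+ l.*2 / kappa ^+ 2) * (4 ^+ l.*2 * l.*2`!%:R).
  apply: (le_trans (x_moments i l2)); rewrite kk; apply: ler_wpM2l.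
    by do 2?[apply: mulr_ge0 => //]; rewrite ?invr_ge0 ?exprn_ge0// ltW.
  rewrite ler_pdivrMr// -mulrA -expr2 -natrX -natrX -natrM ler_nat.
  exact: fact_double_le.
have bound2 : v i ^+ l.*2 <= p i * C ^+ l.*2 * (kappa ^+ l.*2 / kappa ^+ 2) * (4 ^+ l.*2 * l.*2`!%:R).
  have kk1 : 1 <= kappa ^+ l.*2 / kappa ^+ 2.
    rewrite ler_pdivlMr ?exprn_gt0// mul1r; apply: ler_weXn2l => //.
    by case/andP: l2; case: (l) l0.
  have four1 : 2 ^+ l.*2 <= 4 ^+ l.*2 * l.*2`!%:R :> R.
    rewrite -[leLHS]mulr1; apply: ler_pM; rewrite ?exprn_ge0//.
    by apply: lerXn2r; rewrite ?nnegrE//; lra.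
  have pl : p i ^+ l.*2 <= p i.
    case/andP: l2; case: (l.*2) => // k _ _.
    by rewrite exprS -[leRHS]mulr1 ler_wpM2l// exprn_ile1.
  apply: (@le_trans _ _ ((p i * (2 * C)) ^+ l.*2)).
    have pc0 : 0 <= p i * (2 * C) := le_trans v0 vle.
    by apply: lerXn2r; rewrite ?nnegrE.
  rewrite !exprMn (_ : p i ^+ l.*2 * _ = p i ^+ l.*2 * C ^+ l.*2 * 1 * 2 ^+ l.*2); last by ring.
  have Cl0 : 0 <= C ^+ l.*2 by rewrite exprn_ge0// ltW.
  by do 3?[apply: ler_pM => //]; rewrite ?mulr1 ?mulr_ge0 ?exprn_ge0//; exact: ltW.
apply: (le_trans (lerD bound1 bound2)).
set u := _ / _; rewrite (_ : _ + _ = (p i * C ^+ l.*2 * u * l.*2`!%:R) * (2 * 4 ^+ l.*2)); last by ring.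
rewrite (_ : p i / _ * _ * _ = (p i * C ^+ l.*2 * u * l.*2`!%:R) * 8 ^+ l.*2); last first.
  by rewrite /u !exprMn; ring.
apply: ler_wpM2l.
  by rewrite mulr_ge0 ?mulr_ge0 ?invr_ge0 ?exprn_ge0// ltW.
rewrite (_ : 8 = 2 * 4 :> R); last by ring.
rewrite [leRHS]exprMn ler_wpM2r ?exprn_ge0//.
by case/andP: l2; case: (l.*2) => // k _ _; rewrite exprS ler_peMr// exprn_ege1// ler1n.
Qed.

(** The summands are centred but signed, so [dp_even_increment] serves again. The constant is
    [384 = 3 * 2 * 8^2]: the increment bound, the geometric series, and the square of [8 C kappa],
    whose [kappa ^ 2] cancels that of [p i / kappa ^ 2]. *)
Lemma centered_square_sum_moment (s : seq I) (g : I -> R) m :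
  uniq s -> (forall i, 8 * C * kappa * `|g i| <= 2^-1) -> (m.*2 <= N)%N ->
  E (fun w => dp m.*2 (\sum_(i <- s) g i * eta i w)) <=
  expR (\sum_(i <- s) 384 * C ^+ 2 * (g i ^+ 2 * p i)).
Proof.
move=> us gs; elim: s us m => [_ m _|i s IH /= /andP[is_ us] m mN].
  rewrite big_nil expR0 (mf_eq E (g := fun=> dp m.*2 0)); last first.
    by move=> w; rewrite big_nil.
  rewrite (mf_cst mE); case: m => [|m]; rewrite ?dp0// doubleS dpS !mul0r ler01//.
pose J := [set j in s]; have iJ : i \notin J by rewrite inE.
pose X w := \sum_(j <- s) g j * eta j w.
have pX : pol x J X.
  rewrite /X; under eq_fun do rewrite big_seq_cond; apply: pol_sum => j /andP[js _].
  by apply/polZ/pol_eta; rewrite inE.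
pose B := expR (\sum_(j <- s) 384 * C ^+ 2 * (g j ^+ 2 * p j)).
have IHm k : (k.*2 <= N)%N -> E (fun w => dp k.*2 (X w)) <= B by move=> kN; apply: IH.
have pei : pol x [set: I] (eta i) by apply: pol_eta; rewrite inE.
have pei1 : pol x [set i]%SET (eta i) by apply: pol_eta; rewrite inE.
have pTX : pol x [set: I] X by apply: polT pX.
have B0 : 0 <= B := expR_ge0 _.
have /andP[p0 _] := p01 i.
have E0 : E (eta i) = 0.
  rewrite /eta (mf_add mE (f := fun w => x i w ^+ 2) (g := fun=> - v i)).
  - by rewrite (mf_cst mE) subrr.
  - by apply/polX/pol_var; rewrite inE.
  - exact: pol_cst.
have w0 j : 0 <= 384 * C ^+ 2 * (g j ^+ 2 * p j).
  have /andP[pj _] := p01 j; apply: mulr_ge0; last exact: mulr_ge0 (sqr_ge0 _) pj.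
  exact: mulr_ge0 (ler0n _ _) (sqr_ge0 _).
rewrite big_cons expRD -/B.
case: m mN => [_|m mN].
  rewrite (mf_eq E (g := fun=> 1)); last by move=> w; rewrite dp0.
  rewrite (mf_cst mE) -[leLHS]mulr1; apply: ler_pM => //.
    rewrite -[leLHS]expR0 ler_expR; exact: w0.
  by rewrite -[leLHS]expR0 ler_expR; apply: sumr_ge0 => j _; exact: w0.
pose a l : R := 3 * g i ^+ l.+1.*2 / l.+1.*2`!%:R.
pose F3 (l : nat) w := dp (m - l).*2 (X w) * eta i w ^+ l.+1.*2.
have p3 l : pol x [set: I] (F3 l) by rewrite /F3; pol_auto.
have p2 : pol x [set: I] (fun w => dp m.*2.+1 (X w) * eta i w) by pol_auto.
have lhs : E (fun w => dp m.+1.*2 (\sum_(j <- i :: s) g j * eta j w)) <=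
   E (fun w => dp m.+1.*2 (X w)) + \sum_(l < m.+1)
     a l * (E (fun w => dp (m - l).*2 (X w)) * E (fun w => eta i w ^+ l.+1.*2)).
  have -> : E (fun w => dp m.+1.*2 (X w)) + \sum_(l < m.+1)
     a l * (E (fun w => dp (m - l).*2 (X w)) * E (fun w => eta i w ^+ l.+1.*2)) =
    E (fun w => dp m.+1.*2 (X w) + g i * (dp m.*2.+1 (X w) * eta i w) + \sum_(l < m.+1) a l * F3 l w).
    rewrite (mf_add mE); [|by pol_auto|by apply: pol_sum => l _; apply: polZ].
    rewrite (mf_add mE); [|by pol_auto|by pol_auto].
    rewrite (mf_scale mE)// (mf_mul_indep iJ)//; last by pol_auto.
    rewrite E0 !mulr0 addr0; congr (_ + _).
    rewrite (mf_sum mE); last by move=> l _; apply: polZ.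
    apply: eq_bigr => l _; rewrite (mf_scale mE)// /F3.
    rewrite -(mf_mul_indep iJ (f := fun w => dp (m - l).*2 (X w))
      (g := fun w => eta i w ^+ l.+1.*2)); [by []|by pol_auto|by pol_auto].
  apply: (mf_le mE).
  - apply: pol_dp; apply: pol_sum => j _; apply: polZ; apply: pol_eta; rewrite inE//.
  - apply: pol_add; first by pol_auto.
    by apply: pol_sum => l _; apply: polZ.
  move=> w; rewrite big_cons -/(X w) addrC.
  apply: le_trans (dp_even_increment _ _ _) _.
  rewrite le_eqVlt; apply/orP; left; apply/eqP.
  congr (_ + _ + _); first by ring.
  rewrite mulr_sumr; apply: eq_bigr => l _.
  by rewrite /F3 /a /dp exprMn; ring.
apply: (le_trans lhs).
pose y := (8 * C * kappa * g i) ^+ 2.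
have y0 : 0 <= y by exact: sqr_ge0.
have y1 : y <= 2^-1.
  rewrite /y -real_normK ?num_real// normrM.
  rewrite (ger0_norm (_ : 0 <= 8 * C * kappa)); last by rewrite !mulr_ge0// ltW.
  apply: (@le_trans _ _ (2^-1 ^+ 2)); last by rewrite expr2; lra.
  by apply: lerXn2r; rewrite ?nnegrE// !mulr_ge0// ltW.
have h : \sum_(l < m.+1)
     a l * (E (fun w => dp (m - l).*2 (X w)) * E (fun w => eta i w ^+ l.+1.*2))
   <= \sum_(l < m.+1) (3 * p i / kappa ^+ 2) * B * y ^+ l.+1.
  apply: ler_sum => -[l /= lm] _.
  rewrite [leRHS](_ : _ = a l * (B * (p i / kappa ^+ 2 * (8 * C * kappa) ^+ l.+1.*2 * l.+1.*2`!%:R))); last first.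
    rewrite /a /y -exprM mul2n (exprMn _ _ (g i)); field.
    by rewrite pnatr_eq0 -lt0n fact_gt0 gt_eqF.
  apply: ler_wpM2l.
    by rewrite divr_ge0// mulr_ge0// -muln2 exprM sqr_ge0.
  apply: ler_pM.
  - by apply: (mf_ge0 mE) => [|w]; [pol_auto|rewrite dp_even_ge0].
  - by apply: (mf_ge0 mE) => [|w]; [pol_auto|rewrite -muln2 exprM sqr_ge0].
  - by apply: IHm; apply: leq_trans mN; rewrite leq_double (leq_trans (leq_subr _ _)).
  - by apply: centered_square_moment => //; apply: leq_trans mN; rewrite leq_double.
apply: (le_trans (lerD (IHm _ mN) h)).
rewrite -mulr_sumr.
rewrite (_ : _ + _ = (1 + 3 * p i / kappa ^+ 2 * \sum_(l < m.+1) y ^+ l.+1) * B); last by ring.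
rewrite ler_wpM2r//; apply: le_trans (expR_ge1Dx _); rewrite lerD2l.
have k0 : 0 <= 3 * p i / kappa ^+ 2 := divr_ge0 (mulr_ge0 (ler0n _ _) p0) (sqr_ge0 _).
apply: (le_trans (ler_wpM2l k0 (geometric_sum_le m.+1 y0 y1))).
rewrite le_eqVlt; apply/orP; left; apply/eqP; rewrite /y; field.
by rewrite gt_eqF.
Qed.

End sparse_moments.

(** * Moments of quadratic forms *)

Section operator_bound.
Context {R : realType} {I : finType}.
Implicit Types A B : I -> I -> R.

(** The operator norm is at most [a], without a supremum: any upper bound will do, and restrictions,
    products and multiples are immediate. *)
Definition opbound A a := forall y : I -> R,
  \sum_i (\sum_j A i j * y j) ^+ 2 <= a ^+ 2 * \sum_j y j ^+ 2.

Lemma opbound_restrict A a (P Q : pred I) : opbound A a ->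
  opbound (fun i j => (P i)%:R * A i j * (Q j)%:R) a.
Proof.
move=> hA y.
apply: (@le_trans _ _ (\sum_i (\sum_j A i j * ((Q j)%:R * y j)) ^+ 2)).
  apply: ler_sum => i _.
  under eq_bigr do rewrite -!mulrA.
  rewrite -mulr_sumr exprMn; case: (P i); first by rewrite expr1n mul1r.
  by rewrite expr0n mul0r sqr_ge0.
apply: le_trans (hA _) _; rewrite ler_wpM2l ?sqr_ge0//.
apply: ler_sum => j _; case: (Q j); first by rewrite mul1r.
by rewrite mul0r expr0n sqr_ge0.
Qed.

Lemma opbound_mul A B a b : opbound A a -> opbound B b ->
  opbound (fun i k => \sum_j A i j * B j k) (a * b).
Proof.
move=> hA hB y; under eq_bigr => i _.
  rewrite (_ : \sum_j _ = \sum_j A i j * (\sum_k B j k * y k)).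
    over.
  under eq_bigr do rewrite mulr_suml.
  rewrite exchange_big; apply: eq_bigr => j _; rewrite mulr_sumr.
  by apply: eq_bigr => k _; rewrite mulrA.
apply: (le_trans (hA _)); rewrite exprMn -[leRHS]mulrA.
by rewrite ler_wpM2l ?sqr_ge0.
Qed.

Lemma opbound_scale A a u : opbound A a -> opbound (fun i j => u * A i j) (u * a).
Proof.
move=> hA y; under eq_bigr => i _.
  under eq_bigr do rewrite -mulrA.
  rewrite -mulr_sumr exprMn; over.
by rewrite -mulr_sumr exprMn -[leRHS]mulrA ler_wpM2l ?sqr_ge0.
Qed.

Lemma opbound_col A a j : opbound A a -> \sum_i A i j ^+ 2 <= a ^+ 2.
Proof.
move=> hA; have := hA (fun k => (k == j)%:R).
have -> : \sum_k (k == j)%:R ^+ 2 = 1 :> R.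
  rewrite (bigD1 j)//= eqxx expr1n big1 ?addr0// => k /negbTE ->.
  by rewrite expr0n.
rewrite mulr1; apply: le_trans; apply: ler_sum => i _.
rewrite [X in _ <= X ^+ 2](bigD1 j)//= eqxx mulr1 big1 ?addr0// => k /negbTE ->.
by rewrite mulr0.
Qed.

End operator_bound.

(** * Off-diagonal forms as averages of bipartite forms *)

Section off_diagonal.
Context {R : realType} {T : Type} {I : finType}.
Variables (x : I -> T -> R) (E : (T -> R) -> R).
Hypothesis mE : moment_functional x E.

Definition off_form (A : I -> I -> R) (w : T) : R :=
  \sum_i \sum_(j | i != j) A i j * x i w * x j w.

Definition cross_form (A : I -> I -> R) (S : {set I}) (w : T) : R :=
  \sum_(i in S) (\sum_(j in ~: S) A i j * x j w) * x i w.

Lemma pol_off_form A : pol x [set: I]%SET (off_form A).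
Proof.
apply: pol_sum => i _; apply: pol_sum => j _.
by apply: polM; [apply: polZ|]; apply: pol_var; rewrite inE.
Qed.

Lemma pol_cross_form A S : pol x [set: I]%SET (cross_form A S).
Proof.
apply: pol_sum => i _; apply: polM; last by apply: pol_var; rewrite inE.
by apply: pol_sum => j _; apply: polZ; apply: pol_var; rewrite inE.
Qed.

Lemma off_form_expectation A : (forall i, E (x i) = 0) -> E (off_form A) = 0.
Proof.
move=> x0.
have pij i j : pol x [set: I]%SET (fun w => A i j * x i w * x j w).
  by apply: polM; [apply: polZ|]; apply: pol_var; rewrite inE.
rewrite (mf_sum mE); last by move=> i _; exact: pol_sum.
rewrite big1// => i _; rewrite (mf_sum mE); last by move=> j _; exact: pij.
rewrite big1// => j ij.
rewrite (mf_mul mE (J := [set i]%SET) (J' := [set j]%SET)).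
- by rewrite x0 mulr0.
- by rewrite disjoints1 inE.
- by apply/polZ/pol_var; rewrite inE.
- by apply: pol_var; rewrite inE.
Qed.

Lemma mf_ber (q : I -> R) (s : seq I) (f : {set I} -> T -> R) :
  (forall V, pol x [set: I]%SET (f V)) ->
  pol x [set: I]%SET (fun w => ber q s (f^~ w)) /\
  E (fun w => ber q s (f^~ w)) = ber q s (fun V => E (f V)).
Proof.
elim: s f => [|i s IH] f pf /=; first by split; [exact: pf|].
have [p1 e1] := IH f pf; have [p2 e2] := IH (fun V => f (i |: V)) (fun V => pf _).
split; first by apply: pol_add; apply: polZ.
by rewrite (mf_add mE) ?(mf_scale mE) ?e1 ?e2//; apply: polZ.
Qed.

Let half (i : I) : R := 2^-1.
Let half01 i : 0 <= half i <= 1.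
Proof. by rewrite /half invr_ge0 ler0n invf_le1 ?ler1n. Qed.

(** With inclusion probability 1/2, an ordered pair of distinct indices has its first element in [S]
    and its second outside with probability 1/4: hence the factor 4. *)
Lemma off_form_ber A w :
  off_form A w = ber half (enum I) (fun S => 4 * cross_form A S w).
Proof.
have -> : off_form A w = ber half (enum I) (fun S =>
    \sum_i \sum_(j | i != j) (4 * (A i j * x i w * x j w)) *
      ((i \in S)%:R * (j \notin S)%:R)).
  rewrite (ber_sum half01); apply: eq_bigr => i _.
  have -> : (fun V : {set I} => \sum_(j | i != j) (4 * (A i j * x i w * x j w)) *
      ((i \in V)%:R * (j \notin V)%:R)) = (fun V =>
     \sum_(j <- [seq j <- index_enum I | i != j]) (4 * (A i j * x i w * x j w)) *
      ((i \in V)%:R * (j \notin V)%:R)).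
    by apply/funext => V; rewrite big_filter.
  rewrite (ber_sum half01) big_filter; apply: eq_bigr => j ij.
  rewrite berZ ber_in_notin ?enum_uniq ?mem_enum//.
  by rewrite /half; field.
apply: (ber_eq half01) => S _; rewrite /cross_form mulr_sumr.
rewrite [RHS]big_mkcond; apply: eq_bigr => i _.
case: ifPn => iS; last by rewrite big1// => j _; rewrite !mul0r mulr0.
rewrite mulr_suml mulr_sumr [LHS]big_mkcond [RHS]big_mkcond.
apply: eq_bigr => j _; rewrite inE.
have [ij|] := eqVneq i j; first by rewrite -ij iS.
by case: ifP => _ _; rewrite /= ?mulr0// ?mulr1; ring.
Qed.

(** Jensen's inequality for the average over [S], applied pointwise in [w] and then integrated. *)
Lemma off_form_decoupling A k :
  E (fun w => dp (2 ^ k) (off_form A w)) <=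
  ber half (enum I) (fun S => E (fun w => dp (2 ^ k) (4 * cross_form A S w))).
Proof.
have pS S : pol x [set: I]%SET (fun w => dp (2 ^ k) (4 * cross_form A S w)).
  by apply/pol_dp/polZ/pol_cross_form.
have [pb <-] := mf_ber half (enum I) pS.
apply: (mf_le mE) => //; first by apply/pol_dp/pol_off_form.
move=> w; rewrite off_form_ber /dp.
have -> : ber half (enum I) (fun S => (4 * cross_form A S w) ^+ (2 ^ k) / (2 ^ k)`!%:R) =
   ber half (enum I) (fun S => (4 * cross_form A S w) ^+ (2 ^ k)) / (2 ^ k)`!%:R.
  by rewrite mulrC -berZ; apply: (ber_eq half01) => V _; rewrite mulrC.
by rewrite ler_wpM2r ?invr_ge0// (ber_jensen half01).
Qed.

End off_diagonal.

Lemma midpoint_le (R : realType) (u v z : R) :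
  u <= z -> v <= z -> 2^-1 * (u + v) <= z.
Proof. lra. Qed.

(** Here [v] stands for [C a * (c a)]; the bound 1/2 is what [ber_expR_le] asks of its
    coefficients. *)
Lemma step_coef_bound (R : realType) (v : R) : 0 <= v -> v <= 192^-1 * 64^-1 ->
  768 * v + (3072 * v) ^+ 2 <= 2^-1.
Proof.
move=> v0 v1; have h : 3072 * v <= 4^-1 by lra.
have h0 : 0 <= 3072 * v := mulr_ge0 (ler0n _ _) v0.
have := ler_pM h0 h0 h h; rewrite -expr2.
move: (_ ^+ 2) => y; lra.
Qed.

(** The number [9216] is the fixed point of [D = 4608 + D / 2], where [4608] comes from the diagonal
    of the Gram matrix and [D / 2] from its off-diagonal part. This is why the induction keeps its
    constant. *)
Lemma variance_coef_bound (R : realType) (v : R) : v <= 64^-1 * 64^-1 ->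
  4608 + 3072 * 6144 * v <= 9216.
Proof. lra. Qed.

Lemma third_le (R : realType) (v : R) : 3 * v <= 64^-1 -> v <= 192^-1.
Proof. lra. Qed.

(** * The Gram matrix produced by one halving step *)

Section gram_matrix.
Context {R : realType} {T : Type} {I : finType}.
Variables (x : I -> T -> R) (p : I -> R).
Hypothesis p01 : forall i, 0 <= p i <= 1.

Definition off_variance (A : I -> I -> R) : R :=
  \sum_i \sum_(j | i != j) A i j ^+ 2 * p i * p j.

(** For symmetric [A] this is [u B^T B], with [B] the block of [A] with rows in [V] and columns
    outside [S]. It is spelled out as a product of two restrictions of [A] so that [opbound_mul]
    applies. *)
Definition gram (A : I -> I -> R) (S V : {set I}) (u : R) (j k : I) : R :=
  u * \sum_i ((j \notin S)%:R * A j i * (i \in V)%:R) *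
             ((i \in V)%:R * A i k * (k \notin S)%:R).

(** Variance proxy of the random coefficient of [x i] in [cross_form A S]. *)
Definition col_variance (A : I -> I -> R) (S : {set I}) i := \sum_(j in ~: S) A i j ^+ 2 * p j.

Variables (A : I -> I -> R) (a : R).
Hypothesis Asym : forall i j, A i j = A j i.
Hypothesis Aa : opbound A a.
Hypothesis a0 : 0 <= a.

Implicit Types (S V : {set I}) (u : R) (j : I) (w : T).

Lemma opbound_gram S V u : opbound (gram A S V u) (u * (a * a)).
Proof.
apply: opbound_scale; apply: opbound_mul.
  exact: (opbound_restrict (fun j => j \notin S) (fun i => i \in V) Aa).
exact: (opbound_restrict (fun i => i \in V) (fun j => j \notin S) Aa).
Qed.

Lemma gramE S V u j k : gram A S V u j k =
  (j \notin S)%:R * (k \notin S)%:R * (u * \sum_(i in V) A i j * A i k).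
Proof.
rewrite /gram [in RHS]mulrCA; congr (_ * _); rewrite mulr_sumr [RHS]big_mkcond.
apply: eq_bigr => i _; rewrite (Asym j i).
by case: (i \in V) => /=; rewrite ?mulr0 ?mul0r// !mulr1 mul1r; ring.
Qed.

Lemma gram_sym S V u j k : gram A S V u j k = gram A S V u k j.
Proof.
rewrite !gramE [X in X * _]mulrC; congr (_ * (_ * _)).
by apply: eq_bigr => i _; rewrite mulrC.
Qed.

Lemma gram_quadratic_form S V u w : V \subset S ->
  u * \sum_(i in V) (\sum_(j in ~: S) A i j * x j w) ^+ 2 =
  \sum_j gram A S V u j j * x j w ^+ 2 + off_form x (gram A S V u) w.
Proof.
move=> VS; rewrite /off_form -big_split/=.
transitivity (\sum_j \sum_k gram A S V u j k * x j w * x k w); last first.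
  apply: eq_bigr => j _; rewrite (bigD1 j)//=; congr (_ + _).
    by rewrite expr2 mulrA.
  by apply: eq_bigl => k; rewrite eq_sym.
pose z i j := (j \notin S)%:R * (A i j * x j w).
have -> : \sum_(i in V) (\sum_(j in ~: S) A i j * x j w) ^+ 2 =
  \sum_(i in V) \sum_j \sum_k z i j * z i k.
  apply: eq_bigr => i _.
  have -> : \sum_(j in ~: S) A i j * x j w = \sum_j z i j.
    rewrite big_mkcond; apply: eq_bigr => j _; rewrite inE /z.
    by case: (j \in S); rewrite ?mul0r ?mul1r.
  by rewrite expr2 mulr_suml; apply: eq_bigr => j _; rewrite mulr_sumr.
rewrite exchange_big /= mulr_sumr; apply: eq_bigr => j _.
rewrite exchange_big /= mulr_sumr; apply: eq_bigr => k _.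
rewrite gramE /z.
transitivity ((j \notin S)%:R * (k \notin S)%:R * x j w * x k w *
  (u * \sum_(i in V) A i j * A i k)); last by ring.
rewrite [RHS]mulrCA; congr (_ * _); rewrite mulr_sumr.
by apply: eq_bigr => i _; ring.
Qed.

Lemma gram_diag S V u j : gram A S V u j j =
  (j \notin S)%:R * (u * \sum_(i in V) A i j ^+ 2).
Proof.
rewrite gramE; case: (j \notin S); rewrite ?mul0r// !mul1r.
by congr (_ * _); apply: eq_bigr => i _; rewrite expr2.
Qed.

Let sub_sum_le (V : {set I}) (F : I -> R) : (forall i, 0 <= F i) ->
  \sum_(i in V) F i <= \sum_i F i.
Proof.
move=> F0; rewrite big_mkcond; apply: ler_sum => i _.
by case: ifP.
Qed.

Lemma gram_diag_le S V u j : 0 <= u -> gram A S V u j j <= u * a ^+ 2.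
Proof.
move=> u0; rewrite gram_diag.
apply: (@le_trans _ _ (u * \sum_(i in V) A i j ^+ 2)).
  rewrite ler_piMl ?mulr_ge0 ?sumr_ge0// => [i _|]; first exact: sqr_ge0.
  by case: (_ \notin _).
rewrite ler_wpM2l//; apply: le_trans (opbound_col j Aa).
by apply: sub_sum_le => i; exact: sqr_ge0.
Qed.

Lemma gram_diag_variance S V u :
  \sum_j gram A S V u j j * p j = u * \sum_(i in V) col_variance A S i.
Proof.
rewrite mulr_sumr /col_variance; under [RHS]eq_bigr do rewrite mulr_sumr.
rewrite exchange_big [RHS]big_mkcond/=; apply: eq_bigr => j _.
rewrite gram_diag inE; case: (j \notin S); rewrite ?mul0r//.
by rewrite mul1r mulr_sumr mulr_suml; apply: eq_bigr => i _; rewrite mulrA.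
Qed.

(** Bound one factor [p k] by 1: the sum over [k] is then at most the squared norm of [A z_j], with
    [z_j] the column [j] restricted to [V]. The operator bound leaves the sum met on the diagonal,
    with an extra factor [u a^2]. *)
Lemma gram_off_variance S V u :
  off_variance (gram A S V u) <= u ^+ 2 * a ^+ 2 * \sum_(i in V) col_variance A S i.
Proof.
pose z j i := (i \in V)%:R * A i j.
apply: (@le_trans _ _ (\sum_j \sum_k (j \notin S)%:R * p j * u ^+ 2 * (\sum_i A k i * z j i) ^+ 2)).
  apply: ler_sum => j _; rewrite [leLHS]big_mkcond; apply: ler_sum => k _.
  have /andP[pj0 pj1] := p01 j; have /andP[pk0 pk1] := p01 k.
  have rhs0 : 0 <= (j \notin S)%:R * p j * u ^+ 2 * (\sum_i A k i * z j i) ^+ 2.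
    exact: mulr_ge0 (mulr_ge0 (mulr_ge0 (ler0n _ _) pj0) (sqr_ge0 _)) (sqr_ge0 _).
  case: ifP => // _.
  apply: (@le_trans _ _ ((j \notin S)%:R * p j * u ^+ 2 * (\sum_i A k i * z j i) ^+ 2 * p k)); last first.
    by rewrite ler_piMr.
  rewrite ler_wpM2r//.
  have -> : \sum_i A k i * z j i = \sum_(i in V) A i j * A i k.
    rewrite [RHS]big_mkcond; apply: eq_bigr => i _; rewrite /z (Asym k i).
    by case: (i \in V); rewrite ?mul0r ?mulr0// mul1r mulrC.
  rewrite gramE; case: (j \notin S); rewrite ?mul0r ?expr0n ?mul0r//= !mul1r.
  case: (k \notin S); rewrite ?mul1r ?mul0r ?expr0n ?mul0r/=.
    by rewrite le_eqVlt; apply/orP; left; apply/eqP; ring.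
  exact: mulr_ge0 (mulr_ge0 pj0 (sqr_ge0 _)) (sqr_ge0 _).
apply: (@le_trans _ _ (\sum_j (j \notin S)%:R * p j * u ^+ 2 * (a ^+ 2 * \sum_i z j i ^+ 2))).
  apply: ler_sum => j _; rewrite -mulr_sumr ler_wpM2l//.
  have /andP[pj0 pj1] := p01 j.
  exact: mulr_ge0 (mulr_ge0 (ler0n _ _) pj0) (sqr_ge0 _).
rewrite le_eqVlt; apply/orP; left; apply/eqP.
transitivity (u ^+ 2 * a ^+ 2 * (1 * \sum_(i in V) col_variance A S i)); last by rewrite mul1r.
rewrite -gram_diag_variance mulr_sumr; apply: eq_bigr => j _.
rewrite gram_diag mul1r.
have -> : \sum_i z j i ^+ 2 = \sum_(i in V) A i j ^+ 2.
  rewrite [RHS]big_mkcond; apply: eq_bigr => i _; rewrite /z.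
  by case: (i \in V); rewrite ?mul1r// mul0r expr0n.
by ring.
Qed.

End gram_matrix.

(** * Induction on the order of the moment *)

Section quadratic_form_moments.
Context {R : realType} {T : Type} {I : finType}.
Variables (x : I -> T -> R) (E : (T -> R) -> R).
Hypothesis mE : moment_functional x E.
Variables (p : I -> R) (C kappa : R) (N : nat).
Hypothesis p01 : forall i, 0 <= p i <= 1.
Hypothesis C1 : 1 <= C.
Hypothesis kappa1 : 1 <= kappa.
Hypothesis x_centered : forall i, E (x i) = 0.
Hypothesis x_moments : forall i l, (0 < l <= N)%N ->
  E (fun w => x i w ^+ l.*2) <=
    p i * C ^+ l * kappa ^+ (l - 2) * (l.*2`!%:R / l`!%:R).

Let q i := p i / kappa.
Let c := 3 * C * kappa.

Let C_gt0 : 0 < C. Proof. exact: lt_le_trans C1. Qed.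
Let kappa_gt0 : 0 < kappa. Proof. exact: lt_le_trans kappa1. Qed.
Let c_gt0 : 0 < c. Proof. by rewrite !mulr_gt0. Qed.

Let q01 i : 0 <= q i <= 1.
Proof.
have /andP[p0 p1] := p01 i; rewrite /q divr_ge0 ?(ltW kappa_gt0)//=.
by rewrite ler_pdivrMr// mul1r (le_trans p1).
Qed.

Let ca (a : R) : 192 * C * kappa * a <= 1 -> c * a <= 64^-1.
Proof.
by rewrite /c => h; rewrite (_ : 3 * C * kappa * a = 192 * C * kappa * a / 64); [lra|field].
Qed.

(** Midpoint convexity separates the diagonal of the Gram matrix from the rest and doubles [16 c] to
    [32 c]. The diagonal part is a sum of independent squares; the other part falls under the
    induction hypothesis. *)
Lemma off_form_moment_step m (S V : {set I}) (A : I -> I -> R) (a : R) :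
  (forall B b, (forall i j, B i j = B j i) -> opbound B b -> 0 <= b ->
    192 * C * kappa * b <= 1 ->
    E (fun w => dp (2 ^ m) (off_form x B w)) <= expR (9216 * C ^+ 2 * off_variance p B)) ->
  (2 ^ m <= N)%N -> (forall i j, A i j = A j i) -> opbound A a -> 0 <= a ->
  192 * C * kappa * a <= 1 -> V \subset S ->
  E (fun w => dp (2 ^ m) (16 * c * \sum_(i in V) (\sum_(j in ~: S) A i j * x j w) ^+ 2))
  <= expR (\sum_(i in V) (768 * C * c + 9216 * C ^+ 2 * (32 * c) ^+ 2 * a ^+ 2) * col_variance p A S i).
Proof.
move=> IH mN Asym Aa a0 hA VS.
have ca64 := ca hA; have c0 := ltW c_gt0.
have c32 : 0 <= 32 * c := mulr_ge0 (ler0n _ _) c0.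
pose G := gram A S V (32 * c).
have pG : pol x [set: I] (off_form x G) by apply: pol_off_form.
pose D w := \sum_j G j j * x j w ^+ 2.
have pD : pol x [set: I] D.
  by apply: pol_sum => j _; apply/polZ/polX/pol_var; rewrite inE.
have W0 : 0 <= \sum_(i in V) col_variance p A S i.
  apply: sumr_ge0 => i _; apply: sumr_ge0 => j _.
  by have /andP[pj _] := p01 j; rewrite mulr_ge0 ?sqr_ge0.
set W := \sum_(i in V) col_variance p A S i in W0.
have G0 j : 0 <= G j j.
  rewrite /G (gram_diag Asym); apply: mulr_ge0 => //; apply: mulr_ge0 => //.
  by apply: sumr_ge0 => i _; exact: sqr_ge0.
have ca0 : 0 <= c * a := mulr_ge0 c0 a0.
have ca2 : c * a * (c * a) <= 64^-1 * 64^-1 by rewrite ler_pM.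
have diag : E (fun w => dp (2 ^ m) (D w)) <= expR (768 * C * c * W).
  apply: (le_trans (weighted_square_moment mE p01 C1 kappa1 x_moments _ _ _ _)) => //.
  - exact: index_enum_uniq.
  - move=> j; apply: (@le_trans _ _ (4 * c * (32 * c * a ^+ 2))).
      apply: ler_wpM2l; first exact: mulr_ge0 (ler0n _ _) c0.
      exact: (gram_diag_le Asym Aa).
    rewrite (_ : _ * _ = 128 * (c * a * (c * a))); last by ring.
    by lra.
  rewrite ler_expR.
  have -> : \sum_j 8 * (3 * C * kappa) * G j j * (p j / kappa) = 24 * C * \sum_j G j j * p j.
    rewrite mulr_sumr; apply: eq_bigr => j _; field; rewrite gt_eqF//.
  rewrite /G (gram_diag_variance p Asym) -/W.
  by rewrite le_eqVlt; apply/orP; left; apply/eqP; ring.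
have off : E (fun w => dp (2 ^ m) (off_form x G w)) <= expR (9216 * C ^+ 2 * (32 * c) ^+ 2 * a ^+ 2 * W).
  (* As [c a <= 1/64], the new norm bound [32 c a^2] is at most [a / 2]: the smallness condition
     reproduces itself. *)
  have h192 : 192 * C * kappa * (32 * c * (a * a)) <= 1.
    rewrite (_ : _ * _ = (192 * C * kappa * a) * (32 * (c * a))); last by ring.
    rewrite -[leRHS]mulr1; apply: ler_pM; [|exact: mulr_ge0 (ler0n _ _) ca0|exact: hA|lra].
    exact: mulr_ge0 (mulr_ge0 (mulr_ge0 (ler0n _ _) (ltW C_gt0)) (ltW kappa_gt0)) a0.
  have G00 : 0 <= 32 * c * (a * a) := mulr_ge0 c32 (mulr_ge0 a0 a0).
  apply: (le_trans (IH _ _ (gram_sym Asym S V _) (opbound_gram Aa S V _) G00 h192)).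
  rewrite ler_expR.
  apply: (@le_trans _ _ (9216 * C ^+ 2 * ((32 * c) ^+ 2 * a ^+ 2 * W))); last first.
    by rewrite !mulrA.
  apply: ler_wpM2l; first exact: mulr_ge0 (ler0n _ _) (sqr_ge0 _).
  exact: gram_off_variance.
apply: (@le_trans _ _ (2^-1 * (E (fun w => dp (2 ^ m) (D w)) + E (fun w => dp (2 ^ m) (off_form x G w))))).
  rewrite -(mf_add mE); [|exact: pol_dp|exact: pol_dp].
  rewrite -(mf_scale mE); last by apply: pol_add; exact: pol_dp.
  apply: (mf_le mE).
  - apply/pol_dp/polZ/pol_sum => i _; apply/polX/pol_sum => j _.
    by apply/polZ/pol_var; rewrite inE.
  - by apply: polZ; apply: pol_add; exact: pol_dp.
  move=> w.
  have e : 2 * (16 * c * \sum_(i in V) (\sum_(j in ~: S) A i j * x j w) ^+ 2) = D w + off_form x G w.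
    by rewrite /D -(gram_quadratic_form x Asym (32 * c) w VS); ring.
  rewrite (_ : 16 * c * _ = 2^-1 * D w + 2^-1 * off_form x G w); last first.
    by rewrite -mulrDr -e mulKf.
  by apply: le_trans (dp_exp2D _ _ _) _; rewrite !mulrA !divff// !mul1r.
rewrite -mulr_sumr -/W.
have K1 : 0 <= 768 * C * c * W := mulr_ge0 (mulr_ge0 (mulr_ge0 (ler0n _ _) (ltW C_gt0)) c0) W0.
have K2 : 0 <= 9216 * C ^+ 2 * (32 * c) ^+ 2 * a ^+ 2 * W.
  exact: mulr_ge0 (mulr_ge0 (mulr_ge0 (mulr_ge0 (ler0n _ _) (sqr_ge0 _)) (sqr_ge0 _)) (sqr_ge0 _)) W0.
have e1 : expR (768 * C * c * W) <= expR ((768 * C * c + 9216 * C ^+ 2 * (32 * c) ^+ 2 * a ^+ 2) * W).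
  by rewrite ler_expR [leRHS]mulrDl lerDl.
have e2 : expR (9216 * C ^+ 2 * (32 * c) ^+ 2 * a ^+ 2 * W) <= expR ((768 * C * c + 9216 * C ^+ 2 * (32 * c) ^+ 2 * a ^+ 2) * W).
  by rewrite ler_expR [leRHS]mulrDl lerDr.
exact: midpoint_le (le_trans diag e1) (le_trans off e2).
Qed.

Lemma off_form_moment k (A : I -> I -> R) (a : R) :
  (2 ^ k <= N)%N -> (forall i j, A i j = A j i) -> opbound A a -> 0 <= a ->
  192 * C * kappa * a <= 1 ->
  E (fun w => dp (2 ^ k) (off_form x A w)) <= expR (9216 * C ^+ 2 * off_variance p A).
Proof.
elim: k A a => [|m IH] A a kN Asym Aa a0 hA.
  (* Order one is the only odd order; the bound holds there because the form has mean zero. *)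
  rewrite expn0 (mf_eq E (g := off_form x A)); last by move=> w; rewrite dp1.
  rewrite (off_form_expectation mE); first exact: expR_ge0.
  exact: x_centered.
have mN : (2 ^ m <= N)%N by apply: leq_trans kN; rewrite leq_exp2l.
have c0 := ltW c_gt0; have ca64 := ca hA.
have ca0 : 0 <= c * a := mulr_ge0 c0 a0.
have ca2 : c * a * (c * a) <= 64^-1 * 64^-1 by rewrite ler_pM.
apply: (le_trans (off_form_decoupling mE A m.+1)).
have half01 (i : I) : 0 <= (2^-1 : R) <= 1.
  by rewrite invr_ge0 ler0n invf_le1 ?ler1n.
set u := expR _.
rewrite -(ber_cst (fun=> 2^-1) (enum I) u); apply: (ber_le half01) => S _.
rewrite /u {u}.
pose b i w := 4 * \sum_(j in ~: S) A i j * x j w.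
pose K := 768 * C * c + 9216 * C ^+ 2 * (32 * c) ^+ 2 * a ^+ 2.
have cv0 i : 0 <= col_variance p A S i.
  apply: sumr_ge0 => j _; have /andP[pj _] := p01 j.
  exact: mulr_ge0 (sqr_ge0 _) pj.
have cva i : col_variance p A S i <= a ^+ 2.
  apply: le_trans (opbound_col i Aa); rewrite /col_variance big_mkcond.
  apply: ler_sum => j _; rewrite (Asym j i); case: ifP => _; last exact: sqr_ge0.
  by have /andP[pj0 pj1] := p01 j; rewrite ler_piMr// sqr_ge0.
have K0 : 0 <= K.
  apply: addr_ge0; first exact: mulr_ge0 (mulr_ge0 (ler0n _ _) (ltW C_gt0)) c0.
  exact: mulr_ge0 (mulr_ge0 (mulr_ge0 (ler0n _ _) (sqr_ge0 _)) (sqr_ge0 _)) (sqr_ge0 _).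
have step : E (fun w => dp (2 ^ m.+1) (4 * cross_form x A S w)) <=
    ber q (enum S) (fun V => E (fun w => 1 * dp (2 ^ m) (c * \sum_(i in V) b i w ^+ 2))).
  have := linear_form_moment mE p01 C1 kappa1 x_centered x_moments
    (s := enum S) (J := ~: S) (b := b) (H := fun=> 1) (m := 2 ^ m).
  have e : (fun w => 1 * dp (2 ^ m).*2 (\sum_(i <- enum S) b i w * x i w)) =
     (fun w => dp (2 ^ m.+1) (4 * cross_form x A S w)).
    apply/funext => w; rewrite mul1r -mul2n -expnS; congr (dp _ _).
    rewrite big_enum /cross_form mulr_sumr; apply: eq_bigr => i _.
    by rewrite /b mulrA.
  rewrite e; apply => //; first exact: enum_uniq.
  - by move=> i; rewrite mem_enum inE => ->.
  - by move=> i; apply/polZ/pol_sum => j jS; apply/polZ/pol_var.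
  - exact: pol_cst.
apply: (le_trans step).
apply: (@le_trans _ _ (ber q (enum S) (fun V => expR (\sum_(i in V) K * col_variance p A S i)))).
  apply: (ber_le q01) => V VS.
  have VS' : V \subset S.
    by apply/fintype.subsetP => i /(fintype.subsetP VS); rewrite mem_enum.
  have := off_form_moment_step (fun B b => IH B b mN) mN Asym Aa a0 hA VS'.
  apply: le_trans; rewrite le_eqVlt; apply/orP; left; apply/eqP; apply: mf_eq => w.
  have eb : \sum_(i in V) b i w ^+ 2 =
      16 * \sum_(i in V) (\sum_(j in ~: S) A i j * x j w) ^+ 2.
    by rewrite mulr_sumr; apply: eq_bigr => i _; rewrite /b exprMn; ring.
  by rewrite mul1r eb [X in dp _ X]mulrCA [X in dp _ X]mulrA.
have Kc i : 0 <= K * col_variance p A S i <= 2^-1.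
  apply/andP; split; first exact: mulr_ge0.
  apply: (@le_trans _ _ (K * a ^+ 2)); first exact: ler_wpM2l.
  have Ca : C * a <= 192^-1.
    apply: (@le_trans _ _ (C * a * kappa)); first by rewrite ler_peMr// mulr_ge0// ltW.
    have e : c * a = 3 * (C * a * kappa) by rewrite /c; ring.
    by apply: third_le; rewrite -e.
  have Ca0 : 0 <= C * a := mulr_ge0 (ltW C_gt0) a0.
  have v0 : 0 <= C * a * (c * a) := mulr_ge0 Ca0 ca0.
  have v1 : C * a * (c * a) <= 192^-1 * 64^-1 by rewrite ler_pM.
  rewrite (_ : K * _ = 768 * (C * a * (c * a)) + (3072 * (C * a * (c * a))) ^+ 2); last first.
    by rewrite /K; ring.
  exact: step_coef_bound v0 v1.
apply: (le_trans (ber_expR_le q01 (enum_uniq _) Kc)).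
rewrite ler_expR big_enum /=.
apply: (@le_trans _ _ (9216 * C ^+ 2 * \sum_(i in S) p i * col_variance p A S i)).
  rewrite mulr_sumr; apply: ler_sum => i _.
  have /andP[p0 _] := p01 i.
  (* One [kappa] inside [c] cancels against [q i = p i / kappa], so the variance term that survives
     carries no [kappa]. *)
  rewrite [leLHS](_ : _ = C ^+ 2 * (p i * col_variance p A S i) *
      (4608 + 3072 * 6144 * (c * a * (c * a)) * kappa^-1)); last first.
    by rewrite /K /q /c; field; rewrite gt_eqF.
  rewrite [leRHS](_ : _ = C ^+ 2 * (p i * col_variance p A S i) * 9216); last by ring.
  apply: ler_wpM2l; first exact: mulr_ge0 (sqr_ge0 _) (mulr_ge0 p0 (cv0 i)).
  have u0 : 0 <= c * a * (c * a) := mulr_ge0 ca0 ca0.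
  have k1 : c * a * (c * a) * kappa^-1 <= c * a * (c * a).
    by rewrite ler_piMr// invf_le1.
  rewrite -[X in 4608 + X]mulrA; exact: variance_coef_bound (le_trans k1 ca2).
apply: ler_wpM2l; first exact: mulr_ge0 (ler0n _ _) (sqr_ge0 _).
rewrite big_mkcond /off_variance; apply: ler_sum => i _.
have pos (P : pred I) : 0 <= \sum_(j | P j) A i j ^+ 2 * p i * p j.
  apply: sumr_ge0 => j _; have /andP[pi0 _] := p01 i; have /andP[pj0 _] := p01 j.
  exact: mulr_ge0 (mulr_ge0 (sqr_ge0 _) pi0) pj0.
case: ifPn => iS; last exact: pos.
rewrite /col_variance mulr_sumr big_mkcond [leRHS]big_mkcond; apply: ler_sum => j _.
rewrite inE; case: ifPn => jS.
  rewrite ifT; last by apply: contraNneq jS => <-.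
  by rewrite le_eqVlt; apply/orP; left; apply/eqP; ring.
case: ifP => // _; have /andP[pi0 _] := p01 i; have /andP[pj0 _] := p01 j.
exact: mulr_ge0 (mulr_ge0 (sqr_ge0 _) pi0) pj0.
Qed.

(** Midpoint convexity separates diagonal and off-diagonal parts at the price of doubling [A]: hence
    [384 = 2 * 192] and the factor [4 = 2^2]. The order is even, as the diagonal estimate
    demands. *)
Lemma quadratic_form_moment k (A : I -> I -> R) (a : R) :
  (2 ^ k.+1 <= N)%N -> (forall i j, A i j = A j i) -> opbound A a -> 0 <= a ->
  384 * C * kappa * a <= 1 ->
  E (fun w => dp (2 ^ k.+1)
    (\sum_i A i i * (x i w ^+ 2 - E (fun w => x i w ^+ 2)) + off_form x A w))
  <= expR (4 * 9216 * C ^+ 2 * (\sum_i A i i ^+ 2 * p i + off_variance p A)).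
Proof.
move=> kN Asym Aa a0 hA.
pose Z w := \sum_i (2 * A i i) * (x i w ^+ 2 - E (fun w => x i w ^+ 2)).
pose B i j := 2 * A i j.
have pZ : pol x [set: I] Z.
  apply: pol_sum => i _; apply/polZ/pol_add; last exact: pol_cst.
  by apply/polX/pol_var; rewrite inE.
have pB : pol x [set: I] (off_form x B) by exact: pol_off_form.
set m := (2 ^ k.+1)%N in kN *.
have em : m = (2 ^ k).*2 by rewrite /m expnS mul2n.
have D0 : 0 <= \sum_i A i i ^+ 2 * p i.
  by apply: sumr_ge0 => i _; have /andP[pi0 _] := p01 i; rewrite mulr_ge0 ?sqr_ge0.
have O0 : 0 <= off_variance p A.
  apply: sumr_ge0 => i _; apply: sumr_ge0 => j _.
  have /andP[pi0 _] := p01 i; have /andP[pj0 _] := p01 j.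
  exact: mulr_ge0 (mulr_ge0 (sqr_ge0 _) pi0) pj0.
have C20 : 0 <= C ^+ 2 := sqr_ge0 _.
have hZ : E (fun w => dp m (Z w)) <=
    expR (4 * 9216 * C ^+ 2 * (\sum_i A i i ^+ 2 * p i + off_variance p A)).
  rewrite em.
  apply: (le_trans (centered_square_sum_moment mE p01 C1 kappa1 x_moments
    (s := index_enum I) (g := fun i => 2 * A i i) _ _ _)).
  - exact: index_enum_uniq.
  - move=> i; have Aia : `|A i i| <= a.
      rewrite -ler_sqr ?nnegrE// real_normK ?num_real//.
      apply: le_trans (opbound_col i Aa); rewrite (bigD1 i)//= lerDl.
      by apply: sumr_ge0 => j _; exact: sqr_ge0.
    rewrite normrM ger0_norm//.
    apply: (@le_trans _ _ (8 * C * kappa * (2 * a))).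
      apply: ler_wpM2l; last by rewrite ler_pM2l.
      exact: mulr_ge0 (mulr_ge0 (ler0n _ _) (ltW C_gt0)) (ltW kappa_gt0).
    rewrite (_ : 8 * C * kappa * (2 * a) = 24^-1 * (384 * C * kappa * a)); last by field.
    by move: hA; move: (384 * C * kappa * a) => v hv; lra.
  - by rewrite -em.
  rewrite ler_expR.
  rewrite (_ : \sum_(i <- _) _ = 4 * 384 * C ^+ 2 * \sum_i A i i ^+ 2 * p i); last first.
    by rewrite mulr_sumr; apply: eq_bigr => i _; rewrite exprMn; ring.
  apply: ler_pM => //; last by rewrite lerDl.
  - exact: mulr_ge0 (mulr_ge0 (ler0n _ _) (ler0n _ _)) C20.
  - by rewrite ler_wpM2r// ler_pM2l// ler_nat.
have hB : E (fun w => dp m (off_form x B w)) <=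
    expR (4 * 9216 * C ^+ 2 * (\sum_i A i i ^+ 2 * p i + off_variance p A)).
  apply: (le_trans (off_form_moment kN (a := 2 * a) _ _ _ _)).
  - by move=> i j; rewrite /B Asym.
  - exact: opbound_scale.
  - exact: mulr_ge0 (ler0n _ _) a0.
  - by rewrite (_ : _ * _ = 384 * C * kappa * a)//; ring.
  rewrite ler_expR.
  have -> : off_variance p B = 4 * off_variance p A.
    rewrite /off_variance mulr_sumr; apply: eq_bigr => i _.
    by rewrite mulr_sumr; apply: eq_bigr => j _; rewrite /B; ring.
  rewrite (_ : 9216 * C ^+ 2 * (4 * off_variance p A) = 4 * 9216 * C ^+ 2 * off_variance p A); last by ring.
  apply: ler_wpM2l; last by rewrite lerDr.
  exact: mulr_ge0 (mulr_ge0 (ler0n _ _) (ler0n _ _)) C20.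
apply: le_trans (midpoint_le hZ hB).
rewrite -(mf_add mE); [|exact: pol_dp|exact: pol_dp].
rewrite -(mf_scale mE); last by apply: pol_add; exact: pol_dp.
apply: (mf_le mE).
- apply/pol_dp/pol_add; last exact: pol_off_form.
  apply: pol_sum => i _; apply/polZ/pol_add; last exact: pol_cst.
  by apply/polX/pol_var; rewrite inE.
- by apply: polZ; apply: pol_add; exact: pol_dp.
move=> w; apply: le_trans (dp_exp2D _ _ _) _.
have -> : 2 * \sum_i A i i * (x i w ^+ 2 - E (fun w => x i w ^+ 2)) = Z w.
  by rewrite mulr_sumr; apply: eq_bigr => i _; rewrite mulrA.
have -> // : 2 * off_form x A w = off_form x B w.
rewrite mulr_sumr; apply: eq_bigr => i _; rewrite mulr_sumr; apply: eq_bigr => j _.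
by rewrite /B !mulrA.
Qed.

End quadratic_form_moments.

(** * Independence and integration *)

Local Open Scope classical_set_scope.
Local Open Scope ring_scope.

Section integral_of_products.
Context d (T : measurableType d) (R : realType) (P : probability T R).
Local Open Scope ereal_scope.

Import HBNNSimple.

Let simple_value (h : {nnsfun R >-> R}) (z : R) :
  (h z = \sum_(y <- finmap.enum_fset (fset_set (range h))) y * \1_(h @^-1` [set y]) z)%R.
Proof. by rewrite fimfunE fsbig_finite//; exact: fimfunP. Qed.

(** From indicators to simple functions by linearity, then to nonnegative functions by monotone
    convergence, carrying the weight [g] along; the hypothesis with [B] full shows that [c] is the
    integral of [g]. *)
Lemma integral_indep_nonneg (Y g : T -> R) (c : R) :
  measurable_fun setT Y -> measurable_fun setT g -> (forall w, 0 <= g w)%R ->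
  (0 <= c)%R ->
  (forall B : set R, measurable B ->
    \int[P]_w (\1_B (Y w) * g w)%:E = c%:E * P (Y @^-1` B)) ->
  forall f : R -> R, measurable_fun setT f -> (forall y, 0 <= f y)%R ->
    \int[P]_w (f (Y w) * g w)%:E = c%:E * \int[P]_w (f (Y w))%:E.
Proof.
move=> mY mg g0 c0 hB f mf f0.
have mind (B : set R) : measurable B -> measurable_fun setT (fun w => \1_B (Y w) : R).
  by move=> mB; apply: measurableT_comp => //; exact: measurable_indic.
have simple (h : {nnsfun R >-> R}) :
    \int[P]_w (h (Y w) * g w)%:E = c%:E * \int[P]_w (h (Y w))%:E.
  set s := finmap.enum_fset (fset_set (range h)).
  pose B y : set R := h @^-1` [set y].
  have mB y : measurable (B y) by exact: measurable_sfunP.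
  have t0 y z : (0 <= y * \1_(B y) z)%R.
    by have := @nnfun_muleindic_ge0 _ _ _ h y z; rewrite lee_fin.
  have s0 y : y \in s -> (0 <= y)%R.
    rewrite /s in_fset_set; last exact: fimfunP.
    by rewrite inE => -[z _ <-].
  under eq_integral => w _.
    rewrite simple_value -/s mulr_suml -sumEFin.
    over.
  rewrite ge0_integral_sum//; last 2 first.
    by move=> y; apply/measurable_EFinP; apply: measurable_funM => //;
      apply: measurable_funM => //; exact: mind.
    by move=> y w _; rewrite lee_fin mulr_ge0.
  under [in RHS]eq_integral => w _ do rewrite simple_value -/s -sumEFin.
  rewrite [in RHS]ge0_integral_sum//; last 2 first.
    by move=> y; apply/measurable_EFinP; apply: measurable_funM => //; exact: mind.
    by move=> y w _; rewrite lee_fin.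
  rewrite ge0_sume_distrr; last by move=> y _; apply: integral_ge0 => w _; rewrite lee_fin.
  rewrite big_seq [in RHS]big_seq; apply: eq_bigr => y /s0 y0.
  under eq_integral => w _ do rewrite -mulrA EFinM.
  rewrite ge0_integralZl//=; last 2 first.
    by apply/measurable_EFinP; apply: measurable_funM => //; exact: mind.
    by move=> w _; rewrite lee_fin mulr_ge0.
  under [in RHS]eq_integral => w _ do rewrite EFinM.
  rewrite ge0_integralZl//=; last by apply/measurable_EFinP; exact: mind.
  rewrite hB// muleCA; congr (_ * (_ * _)).
  rewrite (_ : (fun w => _) = (fun w => (\1_(Y @^-1` B y) w)%:E)); last first.
    by apply/funext => w; rewrite !indicE.
  rewrite integral_indic// ?setIT// -(setTI (_ @^-1` _)).
  exact: mY.
have mf' : measurable_fun setT (EFin \o f) by exact/measurable_EFinP.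
pose h := nnsfun_approx measurableT mf'.
have hcvg z : (h n z)%:E @[n --> \oo] --> (f z)%:E.
  by apply: cvg_nnsfun_approx => //= y _; rewrite lee_fin.
have hnd z m n : (m <= n)%N -> (h m z <= h n z)%R.
  by move=> mn; exact/lefP/nd_nnsfun_approx.
have mh n : measurable_fun setT (fun w => h n (Y w)) by exact: measurableT_comp.
have c1 : \int[P]_w (h n (Y w) * g w)%:E @[n --> \oo] --> \int[P]_w (f (Y w) * g w)%:E.
  rewrite (_ : (fun w => (f (Y w) * g w)%:E) = fun w => limn (fun n => (h n (Y w) * g w)%:E)).
    apply: cvg_monotone_convergence => //.
    - by move=> n; apply/measurable_EFinP; exact: measurable_funM.
    - by move=> n w _; rewrite lee_fin mulr_ge0.
    - by move=> w _ m n mn; rewrite lee_fin ler_wpM2r// hnd.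
  apply/funext => w; apply/esym/cvg_lim => //.
  under eq_fun do rewrite EFinM.
  by rewrite EFinM; apply: cvgeZr => //; exact: hcvg.
have c2 : \int[P]_w (h n (Y w))%:E @[n --> \oo] --> \int[P]_w (f (Y w))%:E.
  rewrite (_ : (fun w => (f (Y w))%:E) = fun w => limn (fun n => (h n (Y w))%:E)).
    apply: cvg_monotone_convergence => //.
    - by move=> n; exact/measurable_EFinP.
    - by move=> n w _; rewrite lee_fin.
    - by move=> w _ m n mn; rewrite lee_fin hnd.
  by apply/funext => w; apply/esym/cvg_lim => //; exact: hcvg.
have c3 : c%:E * \int[P]_w (h n (Y w))%:E @[n --> \oo] --> c%:E * \int[P]_w (f (Y w))%:E.
  exact: cvgeZl.
have e : (fun n => \int[P]_w (h n (Y w) * g w)%:E) = (fun n => c%:E * \int[P]_w (h n (Y w))%:E).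
  by apply/funext => n; exact: simple.
by move: c1; rewrite e => c1; exact: (cvg_unique _ c1 c3).
Qed.

Section independent_family.
Context {K : finType} (Y : K -> T -> R).
Hypothesis mY : forall k, measurable_fun setT (Y k).
Hypothesis indepY : forall B : K -> set R, (forall k, measurable (B k)) ->
  P (\bigcap_(k in [set: K]) (Y k @^-1` B k)) = \prod_k P (Y k @^-1` B k).

Let measurable_prod_family (f : K -> R -> R) (Q : pred K) :
  (forall k, measurable_fun setT (f k)) ->
  measurable_fun setT (fun w => \prod_(k | Q k) f k (Y k w))%R.
Proof.
move=> mf; rewrite (_ : (fun w => _) =
    fun w => (\prod_(k <- enum Q) f k (Y k w))%R); last first.
  by apply/funext => w; rewrite big_enum.
by apply: measurable_prod => k _; exact: measurableT_comp.
Qed.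

(** The list [J] holds the indices whose function need not be an indicator. Replacing the function
    at its head by any indicator gives, by induction, the hypothesis of [integral_indep_nonneg]; the
    empty list is independence itself. *)
Let integral_prod_indic (J : seq K) (f : K -> R -> R) (e : K -> R) :
  (forall k, measurable_fun setT (f k)) -> (forall k y, 0 <= f k y)%R ->
  (forall k, \int[P]_w (f k (Y k w))%:E = (e k)%:E) ->
  (forall k, k \notin J -> exists2 B : set R, measurable B & f k = \1_B) ->
  \int[P]_w (\prod_k f k (Y k w))%:E = (\prod_k e k)%:E.
Proof.
elim: J f e => [|k0 J IH] f e mf f0 fe hJ.
  have /choice[B hB] : forall k, exists B : set R, measurable B /\ f k = \1_B.
    by move=> k; have [//|B mB fB] := hJ k; exists B.
  have fB k w : f k (Y k w) = \1_(Y k @^-1` B k) w.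
    by rewrite (hB k).2 !indicE.
  have mB k : measurable (Y k @^-1` B k).
    by rewrite -(setTI (_ @^-1` _)); apply: mY => //; exact: (hB k).1.
  have eB k : (e k)%:E = P (Y k @^-1` B k).
    rewrite -fe; under eq_integral do rewrite fB.
    by rewrite integral_indic// setIT.
  rewrite -prodEFin (eq_bigr _ (fun k _ => eB k)) -indepY; last by move=> k; exact: (hB k).1.
  rewrite -[RHS](_ : \int[P]_w (\1_(\bigcap_(k in [set: K]) (Y k @^-1` B k)) w)%:E = _); last first.
    rewrite integral_indic// ?setIT//.
    by apply: fin_bigcap_measurable => //; exact: finite_finset.
  apply: eq_integral => w _; congr (_%:E).
  rewrite indicE; case: (boolP (w \in _)) => [|].
    rewrite inE => h; rewrite big1// => k _; rewrite fB indicE mem_set//; exact: h.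
  rewrite notin_setE => /existsNP[k /not_implyP[_ h]].
  by rewrite (bigD1 k)//= fB indicE memNset// mul0r.
pose g w := (\prod_(k | k != k0) f k (Y k w))%R.
pose c := (\prod_(k | k != k0) e k)%R.
have e0 k : (0 <= e k)%R.
  by rewrite -lee_fin -fe; apply: integral_ge0 => w _; rewrite lee_fin.
transitivity (\int[P]_w (f k0 (Y k0 w) * g w)%:E).
  by apply: eq_integral => w _; rewrite (bigD1 k0).
rewrite (@integral_indep_nonneg _ _ c).
- by rewrite fe -EFinM (bigD1 k0)//= mulrC.
- exact: mY.
- exact: measurable_prod_family.
- by move=> w; apply: prodr_ge0.
- by apply: prodr_ge0.
- move=> B mB.
  have mYB : measurable (Y k0 @^-1` B) by rewrite -(setTI (_ @^-1` _)); exact: mY.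
  pose f' k := if k == k0 then \1_B else f k.
  pose e' k := if k == k0 then fine (P (Y k0 @^-1` B)) else e k.
  have := IH f' e'.
  have -> : \int[P]_w (\prod_k f' k (Y k w))%:E = \int[P]_w (\1_B (Y k0 w) * g w)%:E.
    apply: eq_integral => w _; rewrite (bigD1 k0)//= {1}/f' eqxx; congr (_ * _)%:E.
    by apply: eq_bigr => k /negbTE kk0; rewrite /f' kk0.
  have -> : (\prod_k e' k)%:E = c%:E * P (Y k0 @^-1` B).
    rewrite (bigD1 k0)//= {1}/e' eqxx EFinM fineK ?fin_num_measure// muleC; congr (_%:E * _).
    by apply: eq_bigr => k /negbTE kk0; rewrite /e' kk0.
  apply.
  + by move=> k; rewrite /f'; case: ifP => // _; exact: measurable_indic.
  + by move=> k y; rewrite /f'; case: ifP.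
  + move=> k; rewrite /f' /e'; case: ifP => // /eqP ->.
    rewrite fineK ?fin_num_measure//.
    rewrite (_ : (fun w => _) = (fun w => (\1_(Y k0 @^-1` B) w)%:E)); last first.
      by apply/funext => w; rewrite !indicE.
    by rewrite integral_indic// setIT.
  + move=> k kJ; rewrite /f'; case: ifPn => [_|kk0]; first by exists B.
    by apply: hJ; rewrite inE negb_or kk0.
- exact: mf.
- exact: f0.
Qed.

(** The same scheme for signs: a list holds the indices whose function may take negative values, and
    each such function is split into its positive and negative parts. *)
Lemma integral_prod (f : K -> R -> R) :
  (forall k, measurable_fun setT (f k)) ->
  (forall k, P.-integrable setT (fun w => (f k (Y k w))%:E)) ->
  P.-integrable setT (fun w => (\prod_k f k (Y k w))%:E) /\
  \int[P]_w (\prod_k f k (Y k w))%:E = \prod_k \int[P]_w (f k (Y k w))%:E.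
Proof.
pose e (f : K -> R -> R) k := fine (\int[P]_w (f k (Y k w))%:E).
suff aux (J : seq K) f' : (forall k, measurable_fun setT (f' k)) ->
    (forall k, P.-integrable setT (fun w => (f' k (Y k w))%:E)) ->
    (forall k y, k \notin J -> 0 <= f' k y)%R ->
    P.-integrable setT (fun w => (\prod_k f' k (Y k w))%:E) /\
    \int[P]_w (\prod_k f' k (Y k w))%:E = (\prod_k e f' k)%:E.
  move=> mf fi; have [|i1 i2] := aux (enum K) _ mf fi; first by move=> k y; rewrite mem_enum.
  split => //; rewrite i2 -prodEFin; apply: eq_bigr => k _.
  by rewrite fineK//; exact: integrable_fin_num.
elim: J f' => [|k0 J IH] {}f mf fi f0.
  have ve : \int[P]_w (\prod_k f k (Y k w))%:E = (\prod_k e f k)%:E.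
    apply: (@integral_prod_indic (enum K)) => //.
    - by move=> k y; exact: f0.
    - by move=> k; rewrite fineK//; exact: integrable_fin_num.
    - by move=> k; rewrite mem_enum.
  split => //; apply/integrableP; split.
    exact/measurable_EFinP/measurable_prod_family.
  rewrite (_ : (fun w => _) = (fun w => (\prod_k f k (Y k w))%:E)) ?ve ?ltry//.
  by apply/funext => w; rewrite gee0_abs// lee_fin prodr_ge0// => k _; exact: f0.
(* The positive part for [b = false], the negative part for [b = true]. *)
pose fp (b : bool) y := Num.max ((-1) ^+ b * f k0 y)%R 0%R.
pose F b k := if k == k0 then fp b else f k.
have mfp b : measurable_fun setT (fp b).
  by apply: measurable_maxr => //; exact: measurable_funM.
have mF b k : measurable_fun setT (F b k) by rewrite /F; case: ifP.
have iF b k : P.-integrable setT (fun w => (F b k (Y k w))%:E).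
  rewrite /F; case: ifP => // /eqP ->.
  apply: (le_integrable _ _ _ (fi k0)) => //.
    by apply/measurable_EFinP; exact: measurableT_comp.
  move=> w _; rewrite lee_fin /fp; case: b => /=; rewrite ?expr1 ?expr0 ?mulN1r ?mul1r.
    by rewrite ger0_norm ?le_max ?lexx ?orbT// ge_max normr_ge0 -normrN ler_norm.
  by rewrite ger0_norm ?le_max ?lexx ?orbT// ge_max normr_ge0 ler_norm.
have F0 b k y : k \notin J -> (0 <= F b k y)%R.
  rewrite /F; case: ifPn => [_ _|kk0 kJ]; first by rewrite /fp le_max lexx orbT.
  by apply: f0; rewrite inE negb_or kk0.
have [i1 v1] := IH _ (mF false) (iF false) (F0 false).
have [i2 v2] := IH _ (mF true) (iF true) (F0 true).
have fE y : (f k0 y = fp false y - fp true y)%R.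
  rewrite /fp /= expr0 expr1 mul1r mulN1r; case: (lerP 0 (f k0 y)) => h.
    rewrite [X in (_ - X)%R]max_r ?subr0 ?oppr_le0//.
  by rewrite [X in (_ - X)%R]max_l ?sub0r ?opprK ?oppr_ge0// ltW.
have e1 : (fun w => (\prod_k f k (Y k w))%:E) =
    (fun w => (\prod_k F false k (Y k w))%:E - (\prod_k F true k (Y k w))%:E).
  apply/funext => w; rewrite -EFinB; congr (_%:E).
  rewrite (bigD1 k0)//= [X in _ = (X - _)%R](bigD1 k0)//= [X in _ = (_ - X)%R](bigD1 k0)//=.
  rewrite fE mulrBl /F eqxx; congr (_ * _ - _ * _)%R.
    by apply: eq_bigr => k /negbTE ->.
  by apply: eq_bigr => k /negbTE ->.
rewrite e1; split; first exact: integrableB.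
rewrite integralB//; rewrite v1 v2 -EFinB; congr (_%:E).
rewrite (bigD1 k0)//= [X in (_ - X)%R](bigD1 k0)//= [X in _ = X](bigD1 k0)//=.
rewrite (eq_bigr (e f)) => [|k /negbTE kk0]; last by rewrite /e /F kk0.
rewrite [X in (_ - _ * X)%R](eq_bigr (e f)) => [|k /negbTE kk0]; last by rewrite /e /F kk0.
rewrite -mulrBl; congr (_ * _)%R.
have j b : P.-integrable setT (fun w => (fp b (Y k0 w))%:E).
  by have := iF b k0; rewrite /F eqxx.
rewrite /e /F eqxx -fineB ?integrable_fin_num//; congr fine.
rewrite -integralB//; apply: eq_integral => w _.
by rewrite -EFinB -fE.
Qed.

End independent_family.

End integral_of_products.

(** * Sub-exponential moments *)

Section power_functions.
Context {R : realType}.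
Implicit Types u y z b theta : R.

(** This is [z / y <= exp (z / y)] raised to the power [y]. *)
Lemma powR_le_expR y z : 0 < y -> 0 <= z -> z `^ y <= y `^ y * expR z.
Proof.
move=> y0 z0; have yn : y != 0 by rewrite gt_eqF.
have zy : 0 <= z / y by rewrite divr_ge0// ltW.
rewrite -{1}[z](divfK yn) powRM ?(ltW y0)// mulrC ler_wpM2l ?powR_ge0//.
rewrite -{2}[z](divfK yn) expRM ge0_ler_powR ?nnegrE ?expR_ge0 ?(ltW y0)//.
by apply: le_trans (expR_ge1Dx _); rewrite lerDr.
Qed.

(** Averages the values at [0] and [u] of the tangent line of [exp] at [theta * u]. It serves to
    bring an exponential expectation below 2 by enlarging the scale. *)
Lemma expR_convex0 theta u : 0 <= theta <= 1 ->
  expR (theta * u) <= 1 - theta + theta * expR u.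
Proof.
move=> /andP[t0 t1]; set a := expR (theta * u).
have a0 : 0 <= a := expR_ge0 _.
have h1 : a * (1 - theta * u) <= 1.
  rewrite [leRHS](_ : 1 = a * expR (- (theta * u))); last by rewrite -expRD subrr expR0.
  by rewrite ler_wpM2l// expR_ge1Dx.
have h2 : a * (1 + (u - theta * u)) <= expR u.
  have -> : expR u = a * expR (u - theta * u) by rewrite -expRD addrC subrK.
  by rewrite ler_wpM2l// expR_ge1Dx.
have t1' : 0 <= 1 - theta by rewrite subr_ge0.
have := ler_wpM2l t1' h1; have := ler_wpM2l t0 h2; rewrite mulr1 => g2 g1.
apply: le_trans (lerD g1 g2); rewrite le_eqVlt; apply/orP; left; apply/eqP; ring.
Qed.

(** Used at [b = 2 / alpha]. The [2] is the bound on the exponential expectation, [b ^ b] comes from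
    [(l b)^(l b)], and [exp (2 (b - 1))] pays for the two factors missing from [kappa ^ (l - 2)]. *)
Definition moment_constant b : R := 2 * (b `^ b) * expR (2 * (b - 1)).

Lemma moment_constant_ge1 b : 1 <= b -> 1 <= moment_constant b.
Proof.
move=> b1; rewrite -[leLHS]mul1r; apply: ler_pM => //.
  rewrite -[leLHS]mul1r; apply: ler_pM => //; first by rewrite ler1n.
  by rewrite -(powRr0 b); apply: ler_powR => //; lra.
by apply: le_trans (expR_ge1Dx _); lra.
Qed.

(** In [(l b)^(l b) = (b^b)^l l^l (l^(b-1))^l], the factor [l^l <= (2l)! / l!] is the Gaussian part,
    and [l^(b-1) <= N^(b-1) = kappa] is the excess to be diluted. *)
Lemma powR_moment_bound b (l N : nat) : 1 <= b -> (0 < l <= N)%N ->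
  2 * (l%:R * b) `^ (l%:R * b) <=
  moment_constant b ^+ l * (N%:R `^ (b - 1)) ^+ (l - 2) *
    (l.*2`!%:R / l`!%:R).
Proof.
move=> b1 /andP[l0 lN].
have l1 : 1 <= l%:R :> R by rewrite ler1n.
have lge0 : 0 <= l%:R :> R by rewrite ler0n.
have b0 : 0 <= b by lra.
have c0 : 0 <= b - 1 by lra.
have f0 k : 0 < k`!%:R :> R by rewrite ltr0n fact_gt0.
have e1 : (l%:R * b) `^ (l%:R * b) =
    (b `^ b) ^+ l * (l%:R ^+ l * (l%:R `^ (b - 1)) ^+ l).
  rewrite powRM// mulrC -!powR_mulrn ?powR_ge0// -!powRrM.
  congr (_ * _); first by rewrite mulrC.
  rewrite -powRD; last by apply/implyP => _; rewrite gt_eqF// ltr0n.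
  by congr (_ `^ _); ring.
(* Two of the [l] factors are not compared with [N]: since [ln l <= l], their product is at most
   [exp (2 (b-1) l)]. *)
have e2 : (l%:R `^ (b - 1)) ^+ l <= (N%:R `^ (b - 1)) ^+ (l - 2) * expR (2 * (b - 1)) ^+ l.
  have le1 : l%:R `^ (b - 1) <= N%:R `^ (b - 1).
    by rewrite ge0_ler_powR ?nnegrE ?ler0n// ler_nat.
  case: (l) l0 lN l1 lge0 le1 => [//|[|k]] _ _ _ _ le1.
    rewrite powR1 expr1n mul1r expr1.
    by apply: le_trans (expR_ge1Dx _); lra.
  rewrite -addn2 exprD addnK; apply: ler_pM; rewrite ?exprn_ge0 ?powR_ge0//.
    by apply: lerXn2r; rewrite ?nnegrE ?powR_ge0// addn2.
  set n := (k + 2)%:R : R; have n0 : 0 < n by rewrite ltr0n addn2.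
  have lnn : ln n <= n by rewrite ltW// ln_sublinear.
  rewrite -powR_mulrn ?powR_ge0// -powRrM /powR gt_eqF// -expRM_natl ler_expR.
  rewrite [leRHS](_ : _ = (b - 1) * 2 * n); last by rewrite -/n; ring.
  by rewrite ler_wpM2l// mulr_ge0.
have e3 : l%:R ^+ l <= l.*2`!%:R / l`!%:R :> R.
  by rewrite ler_pdivlMr// -natrX -natrM ler_nat expn_fact_le.
have e4 : 2 <= 2 ^+ l :> R by rewrite -[leLHS]expr1; apply: ler_weXn2l; rewrite ?ler1n.
rewrite e1 /moment_constant !exprMn.
rewrite [leRHS](_ : _ = 2 ^+ l * ((b `^ b) ^+ l * ((l.*2`!%:R / l`!%:R) *
  ((N%:R `^ (b - 1)) ^+ (l - 2) * expR (2 * (b - 1)) ^+ l)))); last by ring.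
apply: ler_pM => //; first by rewrite !mulr_ge0 ?exprn_ge0 ?powR_ge0.
apply: ler_wpM2l; first by rewrite exprn_ge0 ?powR_ge0.
by apply: ler_pM; rewrite ?exprn_ge0 ?powR_ge0.
Qed.

End power_functions.

(** * From sub-exponential tails to exponential and polynomial moments *)

Section sub_exponential_moments.
Context d (T : measurableType d) (R : realType) (P : probability T R).
Variables (alpha : R) (eta : {RV P >-> R}).
Hypothesis alpha0 : 0 < alpha.

Let measurable_exp_power t :
  measurable_fun setT (fun w => expR (`|eta w| `^ alpha / t `^ alpha)).
Proof.
apply: measurableT_comp => //; apply: measurable_funM => //.
apply: (measurableT_comp (measurable_powR alpha)) => //.
exact: measurableT_comp.
Qed.

(* [exp (Z / 2) <= sum_k exp ((k + 1) / 2) 1_{Z >= k}], and the tail bound makes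
   the expectation of the right-hand side a convergent geometric series. *)
Lemma sub_exponential_exp_integrable : sub_exponential P alpha eta ->
  exists2 K : R, 0 < K & (\int[P]_w (expR (2^-1 * (`|eta w| `^ alpha / K `^ alpha)))%:E < +oo)%E.
Proof.
move=> [K K0 hK]; exists K => //.
pose Z w := `|eta w| `^ alpha / K `^ alpha.
have Ka : 0 < K `^ alpha by rewrite powR_gt0.
have Z0 w : 0 <= Z w by rewrite divr_ge0 ?powR_ge0.
have mZ : measurable_fun setT Z.
  apply: measurable_funM => //; apply: (measurableT_comp (measurable_powR alpha)) => //.
  exact: measurableT_comp.
pose A k := [set w | (k%:R <= Z w)%R].
have mA k : measurable (A k).
  rewrite /A -[X in measurable X]setTI.
  by apply: measurable_fun_le => //; exact: measurable_cst.
have PA k : (P (A k) <= (2 * expR (- k%:R))%:E)%E.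
  pose u := k%:R `^ alpha^-1 * K.
  have u0 : 0 <= u by rewrite mulr_ge0 ?powR_ge0// ltW.
  have uE : u `^ alpha = k%:R * K `^ alpha.
    by rewrite powRM ?powR_ge0 ?(ltW K0)// -powRrM mulVf ?gt_eqF// powRr1.
  have mu : measurable [set w | (u <= `|eta w|)%R].
    rewrite -[X in measurable X]setTI; apply: measurable_fun_le => //.
    exact: measurableT_comp.
  apply: (@le_trans _ _ (P [set w | (u <= `|eta w|)%R])).
    apply: le_measure; rewrite ?inE// => w /=; rewrite /A /= /Z ler_pdivlMr// -uE.
    by apply: contraTT; rewrite -!ltNge => h; rewrite gt0_ltr_powR ?nnegrE.
  apply: (le_trans (hK _ u0)); rewrite uE lee_fin mulfK ?gt_eqF//.
pose f k w : \bar R := (expR (2^-1 * k.+1%:R) * \1_(A k) w)%:E.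
have f0 k w : (0 <= f k w)%E by rewrite lee_fin mulr_ge0 ?expR_ge0.
have mf k : measurable_fun setT (f k).
  by apply/measurable_EFinP; apply: measurable_funM => //; exact: measurable_indic.
have point w : ((expR (2^-1 * Z w))%:E <= \sum_(k <oo) f k w)%E.
  have /andP[k1 k2] := truncn_itv (Z0 w); set k := Num.truncn (Z w) in k1 k2.
  apply: le_trans (nneseries_lim_ge k.+1 _); last by move=> *; exact: f0.
  rewrite big_nat_recr//= -[leLHS]add0e; apply: leeD; first by apply: sume_ge0.
  rewrite lee_fin indicE mem_set// mulr1 ler_expR ler_wpM2l// ltW//.
have mE : measurable_fun setT (fun w => (expR (2^-1 * Z w))%:E).
  apply/measurable_EFinP; apply: measurableT_comp => //; exact: measurable_funM.
apply: (@le_lt_trans _ _ (\int[P]_w (\sum_(k <oo) f k w))%E).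
  apply: ge0_le_integral => //.
  - by apply: ge0_emeasurable_sum.
  - by move=> w _; exact: point.
rewrite integral_nneseries//.
pose a : R := 2 * expR 2^-1; pose r : R := expR (- 2^-1).
apply: (@le_lt_trans _ _ (\sum_(k <oo) (geometric a r k)%:E)%E).
  apply: lee_nneseries => [k _|k _]; first by move=> *; exact: integral_ge0.
  rewrite /f; under eq_integral do rewrite EFinM.
  rewrite ge0_integralZl//=; last by apply/measurable_EFinP; exact: measurable_indic.
  rewrite integral_indic// setIT.
  apply: (le_trans (lee_wpmul2l _ (PA k))); first by rewrite lee_fin expR_ge0.
  rewrite -EFinM lee_fin /geometric/= /a /r -expRM_natr -mulrA -expRD.
  rewrite mulrCA -expRD ler_pM2l// ler_expR -natr1.
  by rewrite le_eqVlt; apply/orP; left; apply/eqP; field.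
have r1 : `|r| < 1 by rewrite ger0_norm ?expR_ge0// expR_lt1 oppr_lt0 invr_gt0.
have -> : (\sum_(k <oo) (geometric a r k)%:E)%E = (limn (series (geometric a r)))%:E.
  rewrite -EFin_lim; last exact: is_cvg_geometric_series.
  by congr (limn _); apply/funext => n /=; rewrite sumEFin.
exact: ltry.
Qed.

(** Let [J] be the finite exponential integral at scale [K] and [theta = 1 / max 1 J]. The scale [t]
    multiplies the exponent by [theta], and convexity gives an expectation of at most
    [1 - theta + theta J <= 2]. *)
Lemma sub_exponential_psi_set : sub_exponential P alpha eta ->
  [set t : R | 0 < t /\
    ('E_P[fun w => expR (`|eta w| `^ alpha / t `^ alpha)] <= 2%:E)%E] !=set0.
Proof.
move=> /sub_exponential_exp_integrable[K K0]; set J := (\int[P]_w _)%E => Joo.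
have J0 : (0 <= J)%E by apply: integral_ge0 => w _; rewrite lee_fin expR_ge0.
have Jfin : J \is a fin_num by rewrite ge0_fin_numE.
pose b := Num.max 1 (fine J).
have b1 : 1 <= b by rewrite le_max lexx.
have bJ : fine J <= b by rewrite le_max lexx orbT.
have b0 : 0 < b by exact: lt_le_trans b1.
pose theta := b^-1.
have th0 : 0 < theta by rewrite invr_gt0.
have th1 : theta <= 1 by rewrite invf_le1.
pose t := (2 * b) `^ alpha^-1 * K.
have t0 : 0 < t by rewrite mulr_gt0// powR_gt0// mulr_gt0.
have tE : t `^ alpha = 2 * b * K `^ alpha.
  rewrite powRM ?powR_ge0 ?(ltW K0)// -powRrM mulVf ?gt_eqF// powRr1//.
  by rewrite mulr_ge0// ltW.
exists t; split => //=; rewrite unlock.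
have Ka : K `^ alpha != 0 by rewrite gt_eqF// powR_gt0.
have point w : expR (`|eta w| `^ alpha / t `^ alpha) <=
    (1 - theta) + theta * expR (2^-1 * (`|eta w| `^ alpha / K `^ alpha)).
  have -> : `|eta w| `^ alpha / t `^ alpha = theta * (2^-1 * (`|eta w| `^ alpha / K `^ alpha)).
    by rewrite tE /theta; field; rewrite Ka gt_eqF.
  by apply: expR_convex0; rewrite th1 ltW.
have mexp : measurable_fun setT (fun w => expR (2^-1 * (`|eta w| `^ alpha / K `^ alpha))).
  apply: measurableT_comp => //; apply: measurable_funM => //; apply: measurable_funM => //.
  by apply: (measurableT_comp (measurable_powR alpha)) => //; exact: measurableT_comp.
apply: (@le_trans _ _ (\int[P]_w ((1 - theta)%:E + theta%:E * (expR (2^-1 * (`|eta w| `^ alpha / K `^ alpha)))%:E))%E).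
  apply: ge0_le_integral => //.
  - exact/measurable_EFinP/measurable_exp_power.
  - by apply/measurable_EFinP; apply: measurable_funD => //; exact: measurable_funM.
  - by move=> w _; rewrite -EFinM -EFinD lee_fin; exact: point.
rewrite ge0_integralD//=; last 3 first.
  by move=> w _; rewrite lee_fin subr_ge0.
  by move=> w _; rewrite -EFinM lee_fin mulr_ge0 ?expR_ge0// ltW.
  by apply/measurable_EFinP; exact: measurable_funM.
rewrite [X in (X + _)%E](_ : _ = (1 - theta)%:E); last first.
  by rewrite integral_cst//= probability_setT mule1.
rewrite ge0_integralZl//=; last 2 first.
  exact/measurable_EFinP.
  by rewrite lee_fin ltW.
rewrite -/J -(fineK Jfin) -EFinM -EFinD lee_fin.
have : theta * fine J <= theta * b by rewrite ler_wpM2l// ltW.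
rewrite {2}/theta mulVf ?gt_eqF// => hJ.
by move: hJ th0; lra.
Qed.

(** As [t] lies strictly above the infimum, some smaller scale belongs to the set, and the
    expectation decreases with the scale; whether the infimum is attained does not matter. *)
Lemma psi_norm_expectation t : sub_exponential P alpha eta ->
  psi_norm P alpha eta < t ->
  (\int[P]_w (expR (`|eta w| `^ alpha / t `^ alpha))%:E <= 2%:E)%E.
Proof.
move=> /sub_exponential_psi_set S0 lt.
have [s [s0 hs] st] := inf_lt S0 lt.
have t0 : 0 < t by exact: lt_trans st.
move: hs; rewrite unlock; apply: le_trans; apply: ge0_le_integral => //.
- exact/measurable_EFinP/measurable_exp_power.
- exact/measurable_EFinP/measurable_exp_power.
move=> w _; rewrite lee_fin ler_expR ler_wpM2l ?powR_ge0// lef_pV2 ?posrE ?powR_gt0//.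
by rewrite ge0_ler_powR ?nnegrE// ltW.
Qed.

Lemma exp_moment_bound t k : 0 < t -> (0 < k)%N ->
  (\int[P]_w (expR (`|eta w| `^ alpha / t `^ alpha))%:E <= 2%:E)%E ->
  (\int[P]_w (`|eta w / t| ^+ k)%:E <= (2 * (k%:R / alpha) `^ (k%:R / alpha))%:E)%E.
Proof.
move=> t0 k0 h; pose y := k%:R / alpha.
have y0 : 0 < y by rewrite divr_gt0// ltr0n.
apply: (@le_trans _ _ (\int[P]_w ((y `^ y)%:E * (expR (`|eta w| `^ alpha / t `^ alpha))%:E))%E).
  apply: ge0_le_integral => //.
  - apply/measurable_EFinP; apply: measurable_funX; apply: measurableT_comp => //.
    exact: measurable_funM.
  - by apply/measurable_EFinP; apply: measurable_funM => //; exact: measurable_exp_power.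
  move=> w _; rewrite -EFinM lee_fin.
  have z0 : 0 <= `|eta w| `^ alpha / t `^ alpha by rewrite divr_ge0 ?powR_ge0.
  apply: le_trans (powR_le_expR y0 z0).
  have -> : `|eta w| `^ alpha / t `^ alpha = `|eta w / t| `^ alpha.
    rewrite normrM normfV (ger0_norm (ltW t0)) powRM ?invr_ge0 ?(ltW t0)//.
    by rewrite -(powR_inv1 (ltW t0)) -powRrM mulN1r powRN.
  rewrite -powRrM /y mulrCA divff ?gt_eqF// mulr1 powR_mulrn//.
rewrite ge0_integralZl//=; last 2 first.
  exact/measurable_EFinP/measurable_exp_power.
  by rewrite lee_fin powR_ge0.
rewrite [leRHS]EFinM muleC; apply: lee_wpmul2r => //.
by rewrite lee_fin powR_ge0.
Qed.

End sub_exponential_moments.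

(** * Sparse sub-exponential variables *)

Section sparse_variables.
Context d (T : measurableType d) (R : realType) (P : probability T R).
Variables (n : nat) (p : 'I_n -> R) (delta zeta : 'I_n -> {RV P >-> R}) (s : R).
Hypothesis delta_zeta : independent_sequences P delta zeta.
Hypothesis indep_delta : mutually_independent P delta.
Hypothesis indep_zeta : mutually_independent P zeta.
Hypothesis bern : forall i, is_bernoulli P (delta i) (p i).
Hypothesis zeta_moments : forall i k, (0 < k)%N ->
  (\int[P]_w (`|zeta i w / s| ^+ k)%:E < +oo)%E.

Definition sparse_var (i : 'I_n) (w : T) : R := delta i w * (zeta i w / s).

Definition real_expectation (f : T -> R) : R := fine (\int[P]_w (f w)%:E)%E.

(** Both sequences form one family over the sum type, so that a single product formula covers all
    monomials in the [delta i] and [zeta i]. *)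
Let Y (k : 'I_n + 'I_n) : T -> R :=
  match k with inl i => delta i | inr i => zeta i end.

Let mY k : measurable_fun setT (Y k).
Proof. by case: k. Qed.

Let g_sigma_preimage_bigcap (X : 'I_n -> {RV P >-> R}) (B : 'I_n -> set R) :
  (forall i, measurable (B i)) ->
  g_sigma_preimage X (\bigcap_(i in [set: 'I_n]) (X i @^-1` B i)).
Proof.
move=> mB; rewrite /g_sigma_preimage; set G := (X in <<s X >>).
suff : measurable (\bigcap_(i in [set: 'I_n]) (X i @^-1` B i) : set (g_sigma_algebraType G)) by [].
apply: fin_bigcap_measurable => //.
move=> i _; apply: sub_gen_smallest; rewrite /G.
rewrite (bigD1 i)//=; left; exists (B i) => //.
by rewrite setTI.
Qed.

Let bigcap_finset (X : 'I_n -> {RV P >-> R}) (B : 'I_n -> set R) :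
  mutually_independent P X -> (forall i, measurable (B i)) ->
  P (\bigcap_(i in [set: 'I_n]) (X i @^-1` B i)) = (\prod_i P (X i @^-1` B i))%E.
Proof.
move=> /(_ [set: 'I_n]%SET B) h mB.
have e : [set: 'I_n] = [set` [set: 'I_n]%SET].
  by apply/seteqP; split => i //= _; rewrite inE.
by rewrite e h//; apply: eq_bigl => i; rewrite inE.
Qed.

Let indepY (B : 'I_n + 'I_n -> set R) : (forall k, measurable (B k)) ->
  P (\bigcap_(k in [set: 'I_n + 'I_n]) (Y k @^-1` B k)) =
  (\prod_k P (Y k @^-1` B k))%E.
Proof.
move=> mB; rewrite big_sumType/= -!bigcap_finset// -delta_zeta.
- congr (P _); apply/seteqP; split => w /=.
    by move=> h; split => i _; [exact: (h (inl i))|exact: (h (inr i))].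
  by move=> [h1 h2] [i|i] _; [exact: h1|exact: h2].
- exact: g_sigma_preimage_bigcap.
- exact: g_sigma_preimage_bigcap.
Qed.

Let measurable_delta1 i : measurable [set w | delta i w = 1].
Proof.
rewrite (_ : [set w | _] = delta i @^-1` [set 1]); last by apply/seteqP; split.
by rewrite -(setTI (_ @^-1` _)); exact: measurable_funP.
Qed.

Lemma bernoulli_power i k : (0 < k)%N ->
  P.-integrable setT (fun w => (delta i w ^+ k)%:E) /\
  (\int[P]_w (delta i w ^+ k)%:E = (p i)%:E)%E.
Proof.
move=> k0; have [_ [N [mN PN sN]] Pd] := bern i.
have mdk : measurable_fun setT (fun w => (delta i w ^+ k)%:E).
  exact/measurable_EFinP/measurable_funX.
have m1 : measurable_fun setT (fun w => (\1_[set w | delta i w = 1] w : R)%:E).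
  exact/measurable_EFinP/measurable_indic.
(* The values 0 and 1 are only almost sure, so the power agrees with the indicator of [delta i = 1]
   outside a null set; [k > 0] makes [0 ^ k] vanish. *)
have ae : ae_eq P setT (fun w => (delta i w ^+ k)%:E)
    (fun w => (\1_[set w | delta i w = 1] w : R)%:E).
  exists N; split => // w /= h; apply: sN => /= hd; apply: h => _.
  rewrite indicE; case: hd => hd; rewrite hd; last by rewrite expr1n mem_set.
  rewrite expr0n gtn_eqF// memNset//= hd => /eqP.
  by rewrite eq_sym oner_eq0.
have i1 : (\int[P]_w (\1_[set w | delta i w = 1] w : R)%:E = (p i)%:E)%E.
  by rewrite integral_indic// setIT.
split; last by rewrite (ae_eq_integral _ _ _ _ _ ae).
apply/integrableP; split => //.
rewrite (ae_eq_integral _ _ _ _ _ (ae_eq_comp abse ae)) //; last 2 first.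
  exact: measurableT_comp.
  exact: measurableT_comp.
rewrite (_ : abse \o _ = (fun w => (\1_[set w | delta i w = 1] w : R)%:E)).
  by rewrite i1 ltry.
by apply/funext => w; rewrite /= ger0_norm.
Qed.

Lemma zeta_power_integrable i k :
  P.-integrable setT (fun w => ((zeta i w / s) ^+ k)%:E).
Proof.
have mz : measurable_fun setT (fun w => ((zeta i w / s) ^+ k)%:E).
  by apply/measurable_EFinP/measurable_funX; exact: measurable_funM.
apply/integrableP; split => //.
have [->|k0] := posnP k.
  under eq_integral do rewrite /= expr0 normr1.
  by rewrite integral_cst//= probability_setT mule1 ltry.
under eq_integral do rewrite /= normrX.
exact: zeta_moments.
Qed.

Lemma delta_power_integrable i k :
  P.-integrable setT (fun w => (delta i w ^+ k)%:E).
Proof.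
have [->|k0] := posnP k; last exact: (bernoulli_power i k0).1.
under eq_fun do rewrite expr0; exact: finite_measure_integrable_cst.
Qed.

Lemma integral_sparse_monomial (k : 'I_n -> nat) :
  P.-integrable setT (fun w => (\prod_i sparse_var i w ^+ k i)%:E) /\
  (\int[P]_w (\prod_i sparse_var i w ^+ k i)%:E =
   \prod_i (\int[P]_w (delta i w ^+ k i)%:E * \int[P]_w ((zeta i w / s) ^+ k i)%:E))%E.
Proof.
pose f (j : 'I_n + 'I_n) : R -> R :=
  match j with inl i => fun y => y ^+ k i | inr i => fun y => (y / s) ^+ k i end.
have mf j : measurable_fun setT (f j).
  case: j => i /=; first exact: measurable_funX.
  by apply: measurable_funX; exact: measurable_funM.
have fi j : P.-integrable setT (fun w => (f j (Y j w))%:E).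
  case: j => i /=; [exact: delta_power_integrable|exact: zeta_power_integrable].
have [h1 h2] := integral_prod mY indepY mf fi.
have e : (fun w => (\prod_j f j (Y j w))%:E) = (fun w => (\prod_i sparse_var i w ^+ k i)%:E).
  apply/funext => w; rewrite big_sumType/= -big_split/=; congr (_%:E).
  by apply: eq_bigr => i _; rewrite -exprMn.
rewrite -e; split => //; rewrite h2 big_sumType/= -big_split/=.
by [].
Qed.

Lemma integral_sparse_power i m :
  (\int[P]_w (sparse_var i w ^+ m)%:E =
   \int[P]_w (delta i w ^+ m)%:E * \int[P]_w ((zeta i w / s) ^+ m)%:E)%E.
Proof.
have [_] := integral_sparse_monomial (fun j => if j == i then m else 0%N).
rewrite (bigD1 i)//= eqxx big1 ?mule1 => [<-|j /negbTE ji]; last first.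
  have e (f : T -> R) : (\int[P]_w (f w ^+ 0)%:E = 1)%E.
    under eq_integral do rewrite expr0.
    by rewrite integral_cst//= probability_setT mule1.
  by rewrite ji (e (delta j)) mule1.
apply: eq_integral => w _; congr (_%:E).
by rewrite (bigD1 i)//= eqxx big1 ?mulr1// => j /negbTE ->; rewrite expr0.
Qed.

Lemma pol_integrable (J : {set 'I_n}) f : pol sparse_var J f ->
  P.-integrable setT (fun w => (f w)%:E).
Proof.
elim=> [c k|f1 f2 _ i1 _ i2]; last exact: (integrableD _ i1 i2).
have [i1 _] := integral_sparse_monomial (fun j => if j \in J then k j else 0%N).
rewrite (_ : (fun w => _) = (fun w => c%:E *
   (\prod_j sparse_var j w ^+ (if j \in J then k j else 0))%:E))%E.
  exact: integrableZl.
apply/funext => w; rewrite EFinM; congr (_ * _%:E)%E.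
by rewrite big_mkcond; apply: eq_bigr => j _; case: ifP.
Qed.

Lemma pol_real_expectation (J : {set 'I_n}) f : pol sparse_var J f ->
  (\int[P]_w (f w)%:E = (real_expectation f)%:E)%E.
Proof.
by move=> /pol_integrable pf; rewrite fineK//; exact: integrable_fin_num.
Qed.

Lemma sparse_moment_functional : moment_functional sparse_var real_expectation.
Proof.
split.
- by move=> c; rewrite /real_expectation integral_cst//= probability_setT mule1.
- move=> f g pf pg; apply: EFin_inj; rewrite EFinD.
  rewrite -(pol_real_expectation pf) -(pol_real_expectation pg).
  rewrite -(pol_real_expectation (pol_add pf pg)).
  by apply: integralD_EFin => //; [exact: (pol_integrable pf)|exact: (pol_integrable pg)].
- move=> c f pf; apply: EFin_inj; rewrite EFinM -(pol_real_expectation pf).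
  rewrite -(pol_real_expectation (polZ c pf)).
  under eq_integral do rewrite EFinM.
  by apply: integralZl => //; exact: (pol_integrable pf).
- move=> f g pf pg fg; rewrite -lee_fin -(pol_real_expectation pf) -(pol_real_expectation pg).
  apply: le_integral => //; [exact: (pol_integrable pf)|exact: (pol_integrable pg)|].
  by move=> w _; rewrite lee_fin.
- move=> k.
  have pk i : pol sparse_var [set: 'I_n]%SET (fun w => sparse_var i w ^+ k i).
    by apply/polX/pol_var; rewrite inE.
  rewrite [LHS]/real_expectation (integral_sparse_monomial k).2.
  rewrite -[RHS]/(fine (\prod_i real_expectation (fun w => sparse_var i w ^+ k i))%:E).
  rewrite -prodEFin; congr fine; apply: eq_bigr => i _.
  by rewrite -integral_sparse_power (pol_real_expectation (pk i)).
Qed.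

Lemma sparse_var_centered i : ('E_P[zeta i] = 0)%E ->
  real_expectation (sparse_var i) = 0.
Proof.
rewrite unlock => z0; have := integral_sparse_power i 1; rewrite /real_expectation.
under eq_integral do rewrite expr1.
move=> ->; rewrite (_ : (\int[P]_w ((zeta i w / s) ^+ 1)%:E = 0)%E) ?mule0//.
under eq_integral do rewrite expr1 mulrC EFinM.
(* For [s = 0] the quotient by [s] is [0] by convention. *)
have [s0|s0] := eqVneq s 0.
  by rewrite s0 invr0; under eq_integral do rewrite mul0e; rewrite integral0.
rewrite integralZl ?z0 ?mule0//.
have := zeta_power_integrable i 1; under eq_fun do rewrite expr1 mulrC EFinM.
move=> /(integrableZl measurableT s); apply: eq_integrable => // w _.
by rewrite -!EFinM mulrA divff// mul1r.
Qed.

Lemma sparse_var_moment i m b : (0 < m)%N ->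
  (\int[P]_w (`|zeta i w / s| ^+ m.*2)%:E <= b%:E)%E ->
  real_expectation (fun w => sparse_var i w ^+ m.*2) <= p i * b.
Proof.
move=> m0 hb; have m20 : (0 < m.*2)%N by rewrite double_gt0.
have [/andP[p0 _] _ _] := bern i.
rewrite -lee_fin -(@pol_real_expectation [set: 'I_n]%SET); last first.
  by apply/polX/pol_var; rewrite inE.
rewrite integral_sparse_power (bernoulli_power i m20).2 EFinM lee_wpmul2l ?lee_fin//.
apply: le_trans hb; rewrite le_eqVlt; apply/orP; left; apply/eqP.
apply: eq_integral => w _; congr (_%:E).
by rewrite -muln2 mulnC !exprM real_normK ?num_real.
Qed.

End sparse_variables.

(** * Tail bound *)

Section operator_norm.
Context {R : realType} {n : nat}.
Implicit Types (A : 'M[R]_n) (x y : 'cV[R]_n).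

Lemma l2norm_sqr x : l2norm x ^+ 2 = \sum_i x i ord0 ^+ 2.
Proof. by rewrite /l2norm sqr_sqrtr// sumr_ge0// => i _; exact: sqr_ge0. Qed.

Lemma l2norm_ge0 x : 0 <= l2norm x.
Proof. exact: sqrtr_ge0. Qed.

Lemma opnorm_has_sup A :
  has_sup [set l2norm (A *m x) | x in [set x : 'cV[R]_n | l2norm x <= 1]].
Proof.
split.
  exists (l2norm (A *m 0)), 0 => //=.
  rewrite /l2norm big1 ?sqrtr0 ?ler01// => i _; by rewrite mxE expr0n.
exists (Num.sqrt (\sum_i (\sum_j `|A i j|) ^+ 2)) => _ [x /= x1 <-].
apply: ler_wsqrtr; apply: ler_sum => i _; rewrite mxE -real_normK ?num_real//.
apply: lerXn2r; rewrite ?nnegrE ?sumr_ge0//.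
apply: (le_trans (ler_norm_sum _ _ _)); apply: ler_sum => j _.
rewrite normrM ler_piMr//.
rewrite -ler_sqr ?nnegrE// expr1n real_normK ?num_real//.
apply: (@le_trans _ _ (l2norm x ^+ 2)); last first.
  by rewrite expr_le1 ?l2norm_ge0.
rewrite l2norm_sqr (bigD1 j)//= lerDl sumr_ge0// => k _; exact: sqr_ge0.
Qed.

Lemma opnorm_ge0 A : 0 <= opnorm A.
Proof.
apply: (le_trans (l2norm_ge0 (A *m 0))); apply: sup_upper_bound.
  exact: opnorm_has_sup.
exists 0 => //=.
rewrite /l2norm big1 ?sqrtr0 ?ler01// => i _; by rewrite mxE expr0n.
Qed.

(** By homogeneity [y] is normalized; the zero vector is treated apart. *)
Lemma opbound_opnorm A : opbound (fun i j => A i j) (opnorm A).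
Proof.
move=> y; pose N := \sum_j y j ^+ 2.
have N0 : 0 <= N by apply: sumr_ge0 => j _; exact: sqr_ge0.
move: N0; rewrite le_eqVlt => /predU1P[N0|N0].
  have y0 j : y j = 0.
    apply/eqP; rewrite -sqrf_eq0; apply/eqP; apply: le_anti.
    rewrite sqr_ge0 andbT [leRHS]N0 /N (bigD1 j)//= lerDl sumr_ge0// => k _.
    exact: sqr_ge0.
  rewrite big1 => [|i _]; first by rewrite -/N -N0 mulr0.
  by rewrite big1 ?expr0n// => j _; rewrite y0 mulr0.
pose x : 'cV[R]_n := \col_j (y j / Num.sqrt N).
have xE : l2norm x = 1.
  rewrite /l2norm (_ : \sum_i _ = 1) ?sqrtr1//.
  under eq_bigr do rewrite mxE exprMn exprVn sqr_sqrtr ?(ltW N0)//.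
  by rewrite -mulr_suml divff ?gt_eqF.
have h : l2norm (A *m x) <= opnorm A.
  apply: sup_upper_bound; first exact: opnorm_has_sup.
  by exists x; rewrite //= xE.
have := lerXn2r 2 (l2norm_ge0 _) (opnorm_ge0 A) h.
rewrite l2norm_sqr.
have -> : \sum_i (A *m x) i ord0 ^+ 2 = (\sum_i (\sum_j A i j * y j) ^+ 2) / N.
  rewrite mulr_suml; apply: eq_bigr => i _; rewrite mxE.
  under eq_bigr do rewrite mxE mulrA.
  by rewrite -mulr_suml exprMn exprVn sqr_sqrtr// ltW.
by rewrite ler_pdivrMr.
Qed.

End operator_norm.

(** * Numerical bounds for the choice of the order *)

Section tail_bound.
Context {R : realType}.

Lemma fact_le_expn n : (n`! <= n ^ n)%N.
Proof.
suff h m k : (k <= m -> k`! <= m ^ k)%N by exact: h.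
elim: k => [//|k IH] km; rewrite factS expnS leq_mul// IH// ltnW//.
Qed.

Lemma expR2_le16 : expR 2 <= 16 :> R.
Proof.
have h : expR (2^-1) <= 2 :> R.
  by apply: le_trans (expR_le1D2 _ _) _; rewrite ?invr_ge0//; lra.
have -> : expR 2 = expR (2^-1) ^+ 4 :> R.
  by rewrite -expRM_natl; congr expR; field.
rewrite [leRHS](_ : _ = 2 ^+ 4); last by ring.
by apply: lerXn2r; rewrite ?nnegrE ?expR_ge0.
Qed.

(** After [r! <= r^r] there remains [16^(-r) <= exp (-2 r)]: one [exp (-r)] pays for the moment
    bound [exp r], the other is the tail. *)
Lemma factorial_exp_bound (r : nat) : (0 < r)%N ->
  r`!%:R / (16 * r%:R) ^+ r * expR r%:R <= expR (- r%:R) :> R.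
Proof.
move=> r0; have rr : 0 < r%:R :> R by rewrite ltr0n.
have h1 : r`!%:R / (16 * r%:R) ^+ r <= 16 ^- r :> R.
  rewrite exprMn invfM mulrCA ler_piMr ?invr_ge0 ?exprn_ge0//.
  rewrite ler_pdivrMr ?exprn_gt0// mul1r -natrX ler_nat.
  exact: fact_le_expn.
have h2 : 16 ^- r <= expR (- (2 * r%:R)) :> R.
  rewrite expRN lef_pV2 ?posrE ?exprn_gt0 ?expR_gt0// expRM_natr.
  by apply: lerXn2r; rewrite ?nnegrE ?expR_ge0 ?expR2_le16.
apply: le_trans (ler_wpM2r (expR_ge0 _) (le_trans h1 h2)) _.
by rewrite -expRD ler_expR; lra.
Qed.

(** Dyadic rounding of the ideal order; the exponent [k.+1] makes it even, so that Markov's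
    inequality applies without absolute values. *)
Lemma pow2_between (x : R) : 2 <= x ->
  exists k, (2 ^ k.+1)%:R <= x /\ x <= 2 * (2 ^ k.+1)%:R.
Proof.
move=> x2; have x0 : 0 <= x by lra.
have /andP[m1 m2] := truncn_itv x0; set m := Num.truncn x in m1 m2.
have m3 : (2 <= m)%N by rewrite -ltnS -(ltr_nat R); apply: le_lt_trans x2 _.
have k0 : (0 < trunc_log 2 m)%N by rewrite trunc_log_gt0.
exists (trunc_log 2 m).-1; rewrite prednK//; split.
  by apply: le_trans m1; rewrite ler_nat trunc_logP// ltnW.
rewrite (le_trans (ltW m2))// -natrM ler_nat -expnS.
exact: trunc_log_ltn.
Qed.

End tail_bound.

(** * Tail of the centred quadratic form *)

Section sparse_quadratic_form.
Context d (T : measurableType d) (R : realType) (P : probability T R).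
Variables (alpha : R) (n : nat) (p : 'I_n -> R).
Variables (delta zeta : 'I_n -> {RV P >-> R}) (s : R).
Hypothesis halpha : 0 < alpha <= 2.
Hypothesis delta_zeta : independent_sequences P delta zeta.
Hypothesis indep_delta : mutually_independent P delta.
Hypothesis indep_zeta : mutually_independent P zeta.
Hypothesis bern : forall i, is_bernoulli P (delta i) (p i).
Hypothesis s0 : 0 < s.
Hypothesis zeta_exp : forall i,
  (\int[P]_w (expR (`|zeta i w| `^ alpha / s `^ alpha))%:E <= 2%:E)%E.
Hypothesis zeta0 : forall i, ('E_P[zeta i] = 0)%E.

Let x := sparse_var delta zeta s.
Let E := real_expectation P.

Let alpha0 : 0 < alpha. Proof. by case/andP: halpha. Qed.

Let b1 : 1 <= 2 / alpha.
Proof. by rewrite ler_pdivlMr// mul1r; case/andP: halpha. Qed.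

Let zeta_bound i k : (0 < k)%N ->
  (\int[P]_w (`|zeta i w / s| ^+ k)%:E <=
   (2 * (k%:R / alpha) `^ (k%:R / alpha))%:E)%E.
Proof. by move=> k0; apply: exp_moment_bound. Qed.

Let zeta_moments i k : (0 < k)%N ->
  (\int[P]_w (`|zeta i w / s| ^+ k)%:E < +oo)%E.
Proof. by move=> k0; apply: (le_lt_trans (zeta_bound i k0)); exact: ltry. Qed.

Let mE : moment_functional x E.
Proof. exact: sparse_moment_functional. Qed.

Let p01 i : 0 <= p i <= 1. Proof. by case: (bern i). Qed.

Let C := moment_constant (2 / alpha).

Let x_moments (N : nat) i l : (0 < l <= N)%N ->
  E (fun w => x i w ^+ l.*2) <=
  p i * C ^+ l * (N%:R `^ (2 / alpha - 1)) ^+ (l - 2) * (l.*2`!%:R / l`!%:R).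
Proof.
move=> lN; have /andP[l0 _] := lN; have /andP[p0 _] := p01 i.
have l20 : (0 < l.*2)%N by rewrite double_gt0.
apply: (le_trans (sparse_var_moment delta_zeta indep_delta indep_zeta bern
  zeta_moments l0 (zeta_bound i l20))).
rewrite -!mulrA ler_wpM2l//.
rewrite (_ : l.*2%:R / alpha = l%:R * (2 / alpha)); last first.
  by rewrite -mul2n natrM; ring.
apply: (le_trans (powR_moment_bound b1 lN)).
by rewrite -!mulrA.
Qed.

Lemma markov_power (f : T -> R) (u : R) k : pol x [set: 'I_n]%SET f -> 0 < u ->
  (P [set w | (u <= `|f w|)%R] <= (E (fun w => (f w / u) ^+ (2 ^ k.+1)))%:E)%E.
Proof.
move=> pf u0.
have pfu : pol x [set: 'I_n]%SET (fun w => (f w / u) ^+ (2 ^ k.+1)).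
  by apply: polX; apply: polM => //; exact: pol_cst.
have int := pol_integrable delta_zeta indep_delta indep_zeta bern zeta_moments.
have mf : measurable_fun setT f.
  by apply/measurable_EFinP; exact: (measurable_int P (int _ _ pf)).
have mA : measurable [set w | u <= `|f w|].
  rewrite -[X in measurable X]setTI; apply: measurable_fun_le => //.
  exact: measurableT_comp.
rewrite -(pol_real_expectation delta_zeta indep_delta indep_zeta bern zeta_moments pfu).
rewrite -(setIT [set w | _]) -integral_indic//.
have ev (v : R) : v ^+ (2 ^ k.+1) = `|v| ^+ (2 ^ k.+1).
  by rewrite expnS !exprM real_normK ?num_real.
apply: ge0_le_integral => //.
- exact/measurable_EFinP/measurable_indic.
- exact: (measurable_int P (int _ _ pfu)).
- move=> w _; rewrite lee_fin indicE ev; case: (boolP (w \in _)) => [|_]; last exact: exprn_ge0.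
  rewrite inE /= => h; apply: exprn_ege1.
  by rewrite normrM normfV (gtr0_norm u0) ler_pdivlMr// mul1r.
Qed.

Definition centered_form (A : 'M[R]_n) (w : T) : R :=
  \sum_i A i i * (x i w ^+ 2 - E (fun w => x i w ^+ 2)) +
  off_form x (fun i j => A i j) w.

Lemma pol_centered_form A : pol x [set: 'I_n]%SET (centered_form A).
Proof.
apply: pol_add; last exact: pol_off_form.
apply: pol_sum => i _; apply/polZ/pol_add; last exact: pol_cst.
by apply/polX/pol_var; rewrite inE.
Qed.

(** The form is rescaled by [lam = 64 r / t], which makes [lam t / 4] the [16 r] of
    [factorial_exp_bound]. Its moment bound is [exp (4 * 9216 C^2 lam^2 D)], with [D] the variance
    sum: hence [4096 = 64^2] in [M]. The first inequality on [r] bounds this by [exp r]; the second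
    yields the smallness condition. *)
Lemma centered_form_tail (A : 'M[R]_n) (a t : R) k :
  A^T = A -> opbound (fun i j => A i j) a -> 0 < a -> 0 < t ->
  let r := (2 ^ k.+1)%N in
  let M := 4 * 9216 * 4096 * C ^+ 2 in
  r%:R * M * (\sum_i A i i ^+ 2 * p i + off_variance p (fun i j => A i j)) <= t ^+ 2 ->
  r%:R * M <= (t / a) `^ (alpha / 2) ->
  (P [set w | (t / 4 <= `|centered_form A w|)%R] <= (expR (- r%:R))%:E)%E.
Proof.
move=> AT Aa a0 t0 r M hD hR.
have C1 : 1 <= C := moment_constant_ge1 b1.
have C0 : 0 <= C := le_trans ler01 C1.
have r0 : (0 < r)%N by rewrite expn_gt0.
have rr : 0 < r%:R :> R by rewrite ltr0n.
have r1 : 1 <= r%:R :> R by rewrite ler1n.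
pose lam := 64 * r%:R / t.
have lam0 : 0 < lam by rewrite divr_gt0// mulr_gt0.
set D := (X in _ * X <= _) in hD.
pose kappa := r%:R `^ (2 / alpha - 1) : R.
have k1 : 1 <= kappa.
  by rewrite -(powRr0 (r%:R : R)) /kappa ler_powR//; have := b1; lra.
have CM : 384 * 64 * C <= M.
  rewrite /M (expr2 C) mulrA ler_wpM2r//.
  by apply: le_trans (ler_wpM2l _ C1); rewrite ?mulr1; lra.
have M1 : 1 <= M by lra.
(* As [r kappa = r^(2 / alpha)], the condition reads [r^(2 / alpha) * 384 * 64 C <= t / a]. It
   follows from [hR] raised to the power [2 / alpha], because [384 * 64 C <= M <= M^(2 / alpha)]. *)
have cond : 384 * C * kappa * (lam * a) <= 1.
  have h1 : r%:R `^ (2 / alpha) * (384 * 64 * C) <= t / a.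
    apply: (@le_trans _ _ ((r%:R * M) `^ (2 / alpha))).
      rewrite powRM ?ler0n ?(le_trans ler01)// ler_wpM2l ?powR_ge0//.
      by apply: (le_trans CM); apply: le1r_powR.
    have b0 : 0 <= 2 / alpha := le_trans ler01 b1.
    have ta0 : 0 <= t / a by rewrite divr_ge0 ?ltW.
    have := ge0_ler_powR b0 _ _ hR; rewrite !nnegrE.
    rewrite -powRrM (_ : alpha / 2 * (2 / alpha) = 1) ?powRr1//; last first.
      by field; rewrite gt_eqF.
    by apply; rewrite ?powR_ge0// mulr_ge0// (le_trans ler01).
  rewrite -mulr_powRB1 ?ler0n// in h1; last exact: lt_le_trans b1.
  rewrite -/kappa ler_pdivlMr// in h1.
  rewrite (_ : _ * (lam * a) = (r%:R * kappa * (384 * 64 * C) * a) / t); last first.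
    by rewrite /lam; field; rewrite gt_eqF.
  by rewrite ler_pdivrMr// mul1r.
have pS := pol_centered_form A.
apply: (le_trans (markov_power k pS (_ : 0 < t / 4))); first by rewrite divr_gt0.
rewrite lee_fin -/r.
pose B i j := lam * A i j.
have Asym i j : A i j = A j i by rewrite -{1}AT mxE.
have key := quadratic_form_moment mE p01 C1 k1
  (fun i => sparse_var_centered delta_zeta indep_delta indep_zeta bern zeta_moments (zeta0 i))
  (@x_moments r) (leqnn r) (A := B) (a := lam * a).
have BE w : \sum_i B i i * (x i w ^+ 2 - E (fun w => x i w ^+ 2)) + off_form x B w
   = lam * centered_form A w.
  rewrite /centered_form mulrDr; congr (_ + _).
    by rewrite mulr_sumr; apply: eq_bigr => i _; rewrite mulrA.
  rewrite /off_form mulr_sumr; apply: eq_bigr => i _; rewrite mulr_sumr.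
  by apply: eq_bigr => j _; rewrite /B !mulrA.
have DE : \sum_i B i i ^+ 2 * p i + off_variance p B = lam ^+ 2 * D.
  rewrite /D mulrDr; congr (_ + _).
    by rewrite mulr_sumr; apply: eq_bigr => i _; rewrite /B; ring.
  rewrite /off_variance mulr_sumr; apply: eq_bigr => i _; rewrite mulr_sumr.
  by apply: eq_bigr => j _; rewrite /B; ring.
rewrite DE in key.
have e : E (fun w => (centered_form A w / (t / 4)) ^+ r) =
    r`!%:R / (16 * r%:R) ^+ r * E (fun w => dp r (lam * centered_form A w)).
  rewrite -(mf_scale mE); last by apply/pol_dp/polZ.
  apply: mf_eq => w; rewrite /dp.
  have f0 : r`!%:R != 0 :> R by rewrite pnatr_eq0 -lt0n fact_gt0.
  have -> : r`!%:R / (16 * r%:R) ^+ r * ((lam * centered_form A w) ^+ r / r`!%:R) =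
     ((lam * centered_form A w) / (16 * r%:R)) ^+ r.
    by rewrite expr_div_n; field; rewrite f0 andbT expf_neq0// mulf_neq0 ?gt_eqF.
  rewrite (_ : lam * centered_form A w / _ = centered_form A w / (t / 4))//.
  by rewrite /lam; field; rewrite !gt_eqF.
rewrite e.
apply: le_trans (factorial_exp_bound r0); rewrite ler_wpM2l ?divr_ge0 ?exprn_ge0//.
rewrite -(mf_eq E (fun w => congr1 (dp r) (BE w))).
apply: (le_trans (key _ _ _ _)).
- by move=> i j; rewrite /B Asym.
- exact: opbound_scale.
- by rewrite mulr_ge0// ltW.
- exact: cond.
rewrite ler_expR.
rewrite (_ : _ * _ = (r%:R * M * D) * (r%:R / t ^+ 2)); last first.
  by rewrite /M /lam; field; rewrite gt_eqF.
apply: le_trans (ler_wpM2r _ hD) _; first by rewrite divr_ge0// ?exprn_ge0// ltW.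
by rewrite mulrCA divff ?mulr1// expf_neq0// gt_eqF.
Qed.

End sparse_quadratic_form.

(** * Degenerate cases and the final choice of constants *)

Lemma quad_formE (R : realType) n (A : 'M[R]_n) (v : 'cV[R]_n) :
  quad_form A v = \sum_i \sum_j A i j * v i ord0 * v j ord0.
Proof.
rewrite /quad_form -mulmxA mxE; apply: eq_bigr => i _.
by rewrite !mxE mulr_sumr; apply: eq_bigr => j _; ring.
Qed.

(** The exponent is finite even for [D = 0]: the first quotient is then [+oo] and the minimum is the
    second term. *)
Lemma hw_exponent_real (R : realType) n (alpha : R) (p : 'I_n -> R)
    (A : 'M[R]_n) (t : R) : 0 < t -> 0 < opnorm A ->
  let D := \sum_k A k k ^+ 2 * p k + off_variance p (fun i j => A i j) in
  0 <= D ->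
  exists m, [/\ hw_exponent alpha p A t = m%:E, m * D <= t ^+ 2 &
    m <= (t / opnorm A) `^ (alpha / 2)].
Proof.
move=> t0 a0 D D0; rewrite /hw_exponent -/(off_variance p (fun i j => A i j)) -/D.
rewrite (inver (opnorm A)) (gt_eqF a0) -EFinM poweR_EFin.
set y := (t / opnorm A) `^ _.
move: D0; rewrite le_eqVlt => /predU1P[D0|D0].
  exists y; rewrite -D0 inve0 gt0_muley ?lte_fin ?exprn_gt0// mulr0; split => //.
  exact: sqr_ge0.
exists (Num.min (t ^+ 2 / D) y); rewrite inver (gt_eqF D0) -EFinM -EFin_min; split => //.
  by rewrite -ler_pdivlMr// ge_min lexx.
by rewrite ge_min lexx orbT.
Qed.

Theorem theorem1 (R : realType) (alpha : R) (halpha : 0 < alpha <= 2) :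
  exists2 c : R, 0 < c &
    forall (d : measure_display) (T : measurableType d) (P : probability T R)
      (n : nat) (p : 'I_n -> R) (delta zeta : 'I_n -> {RV P >-> R})
      (A : 'M[R]_n),
    (0 < n)%N ->
    independent_sequences P delta zeta ->
    mutually_independent P delta ->
    (forall i, is_bernoulli P (delta i) (p i)) ->
    mutually_independent P zeta ->
    (forall i, sub_exponential P alpha (zeta i)) ->
    (forall i, 'E_P[zeta i] = 0)%E ->
    A^T = A ->
    let xi := fun w : T => \col_(i < n) (delta i w * zeta i w) in
    let L := \big[Num.max/0]_(i < n) psi_norm P alpha (zeta i) in
    0 < L ->
    forall t : R, 0 <= t ->
    (P [set w | ((L ^+ 2 * t)%:E <=
          `|(quad_form A (xi w))%:E - 'E_P[fun v => quad_form A (xi v)]|)%E]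
     <= 2%:E * expeR (- (c%:E * hw_exponent alpha p A t)))%E.
Proof.
have /andP[alpha0 alpha2] := halpha.
have b1 : 1 <= 2 / alpha by rewrite ler_pdivlMr// mul1r.
set C := moment_constant (2 / alpha).
have C1 : 1 <= C := moment_constant_ge1 b1.
have [M ME] : exists M, M = 4 * 9216 * 4096 * C ^+ 2 by exists (4 * 9216 * 4096 * C ^+ 2).
have M0 : 0 < M.
  rewrite ME; apply: mulr_gt0; last by rewrite exprn_gt0// (lt_le_trans ltr01).
  by lra.
(* Rounding [m / M] down to a power of two costs a factor 2. The other 2 handles [m / M < 2], where
   no even power of two fits: there the exponent is at most 1/2, and [2 exp (-1/2) >= 1]. *)
exists (4 * M)^-1; first by rewrite invr_gt0 mulr_gt0.
move=> d T P n p delta zeta A n0 dz id bern iz sub z0 AT xi L L0 t t0.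
(* Strictly above every norm, as [psi_norm_expectation] requires; in exchange
   [L^2 t = s^2 (t / 4)]. *)
pose s := 2 * L.
have s0 : 0 < s by rewrite mulr_gt0.
have zeta_exp i : (\int[P]_w (expR (`|zeta i w| `^ alpha / s `^ alpha))%:E <= 2%:E)%E.
  apply: psi_norm_expectation => //.
  apply: (@le_lt_trans _ _ L); last by rewrite /s; lra.
  exact: (le_bigmax _ (fun i => psi_norm P alpha (zeta i)) i).
have zm i k : (0 < k)%N -> (\int[P]_w (`|zeta i w / s| ^+ k)%:E < +oo)%E.
  move=> k0; apply: (le_lt_trans (exp_moment_bound alpha0 s0 k0 (zeta_exp i))).
  exact: ltry.
pose x := sparse_var delta zeta s; pose E := real_expectation P.
have mE : moment_functional x E by exact: sparse_moment_functional.
have p01 i : 0 <= p i <= 1 by case: (bern i).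
pose Q w := \sum_i A i i * x i w ^+ 2 + off_form x (fun i j => A i j) w.
have pQ : pol x [set: 'I_n]%SET Q.
  apply: pol_add; last exact: pol_off_form.
  by apply: pol_sum => i _; apply/polZ/polX/pol_var; rewrite inE.
have quadE w : quad_form A (xi w) = s ^+ 2 * Q w.
  have xiE i : xi w i ord0 = s * x i w.
    by rewrite /xi mxE /x /sparse_var; field; rewrite gt_eqF.
  rewrite quad_formE /Q /off_form -big_split/= mulr_sumr; apply: eq_bigr => i _.
  rewrite (bigD1 i)//= mulrDr !xiE; congr (_ + _); first by ring.
  rewrite mulr_sumr; apply: eq_big => [j|j _]; first by rewrite eq_sym.
  by rewrite xiE; ring.
have EquadE : ('E_P[fun v => quad_form A (xi v)] = (s ^+ 2 * E Q)%:E)%E.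
  rewrite unlock -(mf_scale mE)// -(pol_real_expectation dz id iz bern zm (polZ (s ^+ 2) pQ)).
  by apply: eq_integral => w _; rewrite quadE.
have QE w : Q w - E Q = centered_form delta zeta s A w.
  have -> : E Q = \sum_i A i i * E (fun w => x i w ^+ 2).
    rewrite /Q (mf_add mE); [|by apply: pol_sum => i _; apply/polZ/polX/pol_var; rewrite inE
      |exact: pol_off_form].
    rewrite (off_form_expectation mE) ?addr0; last first.
      by move=> i; exact: (sparse_var_centered dz id iz bern zm (z0 i)).
    rewrite (mf_sum mE); last by move=> i _; apply/polZ/polX/pol_var; rewrite inE.
    by apply: eq_bigr => i _; rewrite (mf_scale mE)//; apply/polX/pol_var; rewrite inE.
  rewrite /Q /centered_form addrAC; congr (_ + _).
  by rewrite -sumrB; apply: eq_bigr => i _; rewrite mulrBr.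
have -> : [set w | ((L ^+ 2 * t)%:E <=
    `|(quad_form A (xi w))%:E - 'E_P[fun v => quad_form A (xi v)]|)%E] =
   [set w | t / 4 <= `|centered_form delta zeta s A w|].
  apply/seteqP; split => w /=; rewrite EquadE quadE -EFinB abse_EFin lee_fin;
    rewrite -mulrBr QE normrM (ger0_norm (sqr_ge0 s)) (_ : s ^+ 2 * _ = L ^+ 2 *
      (4 * `|centered_form delta zeta s A w|)) ?ler_pM2l ?exprn_gt0//;
    (try by rewrite /s; ring); lra.
have mevent : measurable [set w | t / 4 <= `|centered_form delta zeta s A w|].
  have pc := pol_centered_form delta zeta s A.
  rewrite -[X in measurable X]setTI; apply: measurable_fun_le => //.
  apply: measurableT_comp => //; apply/measurable_EFinP.
  exact: (measurable_int P (pol_integrable dz id iz bern zm pc)).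
have rhs0 c y : (0 <= 2%:E * expeR (- (c%:E * y)) :> \bar R)%E.
  by rewrite mule_ge0 ?lee_fin// expeR_ge0.
(* At [t = 0] both terms of the minimum are 0, also over a zero denominator, and the claimed bound
   is 2. *)
move: t0; rewrite le_eqVlt => /predU1P[t0|t0].
  have -> : hw_exponent alpha p A t = 0%E.
    rewrite /hw_exponent -t0 expr0n/= !mul0e poweR0r ?minxx//.
    by rewrite mulf_neq0 ?invr_eq0 ?gt_eqF.
  rewrite mule0 oppe0 expeR0 mule1; apply: (le_trans (probability_le1 _ mevent)).
  by rewrite lee_fin ler1n.
(* If the norm is zero then [A] vanishes, and the event is empty because [t > 0]. *)
have := opnorm_ge0 A; rewrite le_eqVlt => /predU1P[a0|a0].
  have A0 i j : A i j = 0.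
    apply/eqP; rewrite -sqrf_eq0; apply/eqP/le_anti; rewrite sqr_ge0 andbT.
    have := opbound_col j (opbound_opnorm A); rewrite -a0 expr0n/=; apply: le_trans.
    by rewrite (bigD1 i)//= lerDl sumr_ge0// => k _; exact: sqr_ge0.
  rewrite (_ : [set w | _] = set0) ?measure0//.
  apply/seteqP; split => w //=; rewrite /centered_form /off_form.
  rewrite big1 ?add0r => [|i _]; last by rewrite A0 mul0r.
  rewrite big1 ?normr0 => [|i _]; last by rewrite big1// => j _; rewrite A0 !mul0r.
  by rewrite leNgt divr_gt0.
have D0 : 0 <= \sum_k A k k ^+ 2 * p k + off_variance p (fun i j => A i j).
  apply: addr_ge0; apply: sumr_ge0 => i _; have /andP[pi0 _] := p01 i.
    exact: mulr_ge0 (sqr_ge0 _) pi0.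
  apply: sumr_ge0 => j _; have /andP[pj0 _] := p01 j.
  exact: mulr_ge0 (mulr_ge0 (sqr_ge0 _) pi0) pj0.
have [m [-> mD my]] := hw_exponent_real alpha t0 a0 D0.
rewrite (_ : (_ * _)%E = (2 * expR (- ((4 * M)^-1 * m)))%:E)//.
have [R2|R2] := leP 2 (m / M).
  have [k [k1 k2]] := pow2_between R2.
  apply: (le_trans (centered_form_tail halpha dz id iz bern s0 zeta_exp z0 AT
    (opbound_opnorm A) a0 t0 (k := k) _ _)).
  - by rewrite -/C -ME; apply: le_trans mD; apply: ler_wpM2r => //; rewrite -ler_pdivlMr.
  - by rewrite -/C -ME; apply: le_trans my; rewrite -ler_pdivlMr.
  rewrite lee_fin; apply: (@le_trans _ _ (expR (- ((4 * M)^-1 * m)))).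
    rewrite ler_expR lerN2 (_ : _ * m = 4^-1 * (m / M)); last by field; rewrite gt_eqF.
    by lra.
  by rewrite ler_peMl ?expR_ge0// ler1n.
apply: (le_trans (probability_le1 _ mevent)).
rewrite lee_fin.
have : (4 * M)^-1 * m <= 2^-1.
  by rewrite (_ : _ * m = 4^-1 * (m / M)); [lra|field; rewrite gt_eqF].
have := expR_ge1Dx (- ((4 * M)^-1 * m)); lra.
Qed.
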